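(* Let $n \geq 1$ be an integer and let $A$ be a $2n \times 2n$ real symmetric matrix. If $\det(2A \pm J) \neq 0$, then the operator $T_{\mu_A}$, $T_{\mu_A} f = f \ast \mu_A$, is bounded from $L^{\frac{2n+2}{2n+1}}(\mathbb{H}^{n})$ to $L^{2n+2}(\mathbb{H}^{n})$.
   Context: $I_n$ is the $n\times n$ identity matrix and $J = \begin{pmatrix} 0 & I_n \\ -I_n & 0 \end{pmatrix}$ (a $2n\times 2n$ matrix). The Heisenberg group is $\mathbb{H}^{n} = \mathbb{R}^{2n}\times\mathbb{R}$ with group law $(x,t)\cdot(y,s) = (x+y,\, t+s+\langle x,y\rangle)$, where $\langle x,y\rangle = x^{t}Jy$; the neutral element is $(0,0)$ and $(x,t)^{-1}=(-x,-t)$. Its topology and Borel sets are those of $\mathbb{R}^{2n+1}$, and its Haar measure is Lebesgue measure on $\mathbb{R}^{2n+1}$, so $L^{p}(\mathbb{H}^{n}) = L^{p}(\mathbb{R}^{2n+1})$. For a Borel measure $\mu$ on $\mathbb{H}^n$ and a Borel function $f:\mathbb{H}^n\to\mathbb{C}$, $(f\ast\mu)(x,t) = \int_{\mathbb{H}^n} f((x,t)\cdot(y,s)^{-1})\, d\mu(y,s)$, provided the integral exists, and $T_\mu f = f\ast\mu$. Let $\varphi(y) = y^{t}Ay$ for $y\in\mathbb{R}^{2n}$. The measure $\mu_A$ on $\mathbb{H}^n$ is defined by $\mu_A(E) = \int_{\mathbb{R}^{2n}} \chi_E(y,\varphi(y))\, dy$ for Borel sets $E\subset\mathbb{H}^n$.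 ''$T_\mu$ is bounded from $L^p(\mathbb{H}^n)$ to $L^q(\mathbb{H}^n)$'' means there is a constant $c<\infty$ such that, for every Borel $f\in L^p(\mathbb{H}^n)$, $f\ast\mu$ is defined almost everywhere and $\|f\ast\mu\|_q \leq c\|f\|_p$. Since $A$ is symmetric, $\det(2A+J)=\det(2A-J)$, so $\det(2A\pm J)\neq 0$ is a single condition. *)

(* Defs.v *)
From HB Require Import structures.
From mathcomp Require Import all_boot all_order all_algebra.
From mathcomp Require Import all_classical all_reals all_analysis.
From mathcomp Require Import measurable_realfun complex.

Set Implicit Arguments.
Unset Strict Implicit.
Unset Printing Implicit Defensive.

Import Order.TTheory GRing.Theory Num.Theory.
Import numFieldNormedType.Exports.

Local Open Scope classical_set_scope.
Local Open Scope ring_scope.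

(* The library proves this but its SigmaFiniteMeasure instance on [\x] is
   shadowed by the one for subprobabilities. *)
Lemma product_measure1_sigma_finite d1 d2 (T1 : measurableType d1)
    (T2 : measurableType d2) (R : realType)
    (m1 : {sigma_finite_measure set T1 -> \bar R})
    (m2 : {sigma_finite_measure set T2 -> \bar R}) :
  sigma_finite setT (m1 \x m2)%E.
Proof.
have /sigma_finiteP[F [TF ndF Foo]] := sigma_finiteT m1.
have /sigma_finiteP[G [TG ndG Goo]] := sigma_finiteT m2.
exists (fun k => F k `*` G k).
  rewrite -setXTT TF TG predeqE => -[x y]; split.
    move=> [/= [k _ Fkx] [l _ Gly]]; exists (maxn k l) => //; split.
    - by move: x Fkx; exact/subsetPset/ndF/leq_maxl.
    - by move: y Gly; exact/subsetPset/ndG/leq_maxr.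
  by move=> [k _ []/= ? ?]; split; exists k.
move=> k; have [mF Fk] := Foo k; have [mG Gk] := Goo k.
split; first exact: measurableX.
by rewrite product_measure1E// lte_mul_pinfty// ge0_fin_numE.
Qed.

(* R^m. The library's sigma-algebra on tuples is generated by the coordinates:
   here it is the Borel sigma-algebra of R^m. [measurableTypeR R] is R with the
   measurable structure that carries [lebesgue_measure]. *)
Notation "'euc[ R ]_ m" := (m.-tuple (measurableTypeR R))
  (at level 0, m at level 2, format "''euc[' R ]_ m") : type_scope.

(* Lebesgue measure on R^m is the m-fold product of [lebesgue_measure], built by
   recursion on m along the bijection R * R^m -> R^(m+1). *)

Section lebesgue_cons.
Context (R : realType) (m : nat).

Definition cons_pair (p : measurableTypeR R * 'euc[R]_m) : 'euc[R]_m.+1 :=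
  [the m.+1.-tuple _ of p.1 :: p.2].

Definition uncons_pair (t : 'euc[R]_m.+1) :
    measurableTypeR R * 'euc[R]_m :=
  (thead t, [tuple of behead t]).

Lemma tnth_cons_pair0 p : tnth (cons_pair p) ord0 = p.1.
Proof. exact: tnth0. Qed.

Lemma tnth_cons_pairS p i : tnth (cons_pair p) (lift ord0 i) = tnth p.2 i.
Proof. exact: tnthS. Qed.

Lemma cons_pairK : cancel cons_pair uncons_pair.
Proof. by case=> a t; congr pair; exact: val_inj. Qed.

Lemma uncons_pairK : cancel uncons_pair cons_pair.
Proof. by move=> t; rewrite [RHS]tuple_eta. Qed.

Lemma measurable_cons_pair :
  measurable_fun [set: measurableTypeR R * 'euc[R]_m] cons_pair.
Proof. exact: measurable_cons. Qed.

Lemma measurable_uncons_pair :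
  measurable_fun [set: 'euc[R]_m.+1] uncons_pair.
Proof.
apply: measurable_fun_pair; last exact: measurable_behead.
exact: measurable_tnth.
Qed.

Variable mu : {sigma_finite_measure set ('euc[R]_m) -> \bar R}.

Definition lebesgue_cons : set ('euc[R]_m.+1) -> \bar R :=
  pushforward (@lebesgue_measure R \x mu)%E cons_pair.

Let lebesgue_cons0 : lebesgue_cons set0 = 0%E.
Proof. by rewrite /lebesgue_cons /pushforward preimage_set0 measure0. Qed.

Let lebesgue_cons_ge0 A : (0 <= lebesgue_cons A)%E.
Proof. by rewrite /lebesgue_cons /pushforward measure_ge0. Qed.

Let lebesgue_cons_sigma_additive : semi_sigma_additive lebesgue_cons.
Proof.
move=> F mF tF mUF; rewrite /lebesgue_cons /pushforward preimage_bigcup.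
apply: measure_semi_sigma_additive.
- by move=> n; rewrite -[X in measurable X]setTI; exact: measurable_cons_pair.
- apply/trivIsetP => /= i j _ _ ij; rewrite -preimage_setI.
  by move/trivIsetP : tF => /(_ _ _ _ _ ij) ->//; rewrite preimage_set0.
- rewrite -preimage_bigcup -[X in measurable X]setTI.
  exact: measurable_cons_pair.
Qed.

HB.instance Definition _ := isMeasure.Build _ _ _ lebesgue_cons
  lebesgue_cons0 lebesgue_cons_ge0 lebesgue_cons_sigma_additive.

Let lebesgue_cons_sigma_finite : sigma_finite setT lebesgue_cons.
Proof.
have [F FT Foo] : sigma_finite setT (@lebesgue_measure R \x mu)%E.
  exact: product_measure1_sigma_finite.
exists (fun k => uncons_pair @^-1` F k).
  by rewrite -preimage_bigcup -FT preimage_setT.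
move=> k; have [mF Fk] := Foo k; split.
  by rewrite -[X in measurable X]setTI; exact: measurable_uncons_pair.
rewrite /lebesgue_cons /pushforward -comp_preimage.
by rewrite (_ : _ \o _ = id) //; apply/funext => p; exact: cons_pairK.
Qed.

HB.instance Definition _ := Measure_isSigmaFinite.Build _ _ _ lebesgue_cons
  lebesgue_cons_sigma_finite.

End lebesgue_cons.

Fixpoint lebesgue_rec (R : realType) (m : nat) :
    {sigma_finite_measure set ('euc[R]_m) -> \bar R} :=
  match m with
  | 0 => \d_([tuple] : 'euc[R]_0)
  | k.+1 => lebesgue_cons (lebesgue_rec R k)
  end.

Definition lebesgue_tuple (R : realType) (m : nat) :
    set ('euc[R]_m) -> \bar R :=
  lebesgue_rec R m.

HB.instance Definition _ (R : realType) (m : nat) :=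
  SigmaFiniteMeasure.copy (@lebesgue_tuple R m) (lebesgue_rec R m).

Lemma lebesgue_tuple_box (R : realType) (m : nat)
    (B : 'I_m -> set (measurableTypeR R)) :
  (forall i, measurable (B i)) ->
  lebesgue_tuple [set t : 'euc[R]_m | forall i, B i (tnth t i)] =
  (\prod_(i < m) lebesgue_measure (B i))%E.
Proof.
elim: m B => [|m IHm] B mB.
  rewrite big_ord0 (_ : [set _ | _] = setT) /lebesgue_tuple /=.
    by rewrite diracT.
  by apply/seteqP; split=> // t _ [].
rewrite big_ord_recl -IHm => [|i]; last exact: mB.
rewrite {1}/lebesgue_tuple /= /lebesgue_cons /pushforward.
rewrite -product_measure1E; [|exact: mB|].
  congr ((_ \x _)%E _); apply/seteqP; split=> -[a t] /=.
    move=> Bt; split=> [|i].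
      by have := Bt ord0; rewrite tnth_cons_pair0.
    by have := Bt (lift ord0 i); rewrite tnth_cons_pairS.
  case=> /= Ba Bt i; have [->|i0] := eqVneq i ord0.
    by rewrite tnth_cons_pair0.
  have i1m : (i.-1 < m)%N by rewrite prednK ?lt0n// -ltnS.
  have -> : i = lift ord0 (Ordinal i1m).
    by apply/val_inj => /=; rewrite /bump/= add1n prednK// lt0n.
  by rewrite tnth_cons_pairS; exact: Bt.
rewrite (_ : [set _ | _] = \bigcap_(i in [set: 'I_m])
    ((fun t : 'euc[R]_m => tnth t i) @^-1` B (lift ord0 i))).
  apply: fin_bigcap_measurable => // i _.
  rewrite -[X in measurable X]setTI.
  by apply: (@measurable_tnth _ (measurableTypeR R)) => //; exact: mB.
apply/seteqP; split=> t Bt i; first by move=> _; exact: Bt.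
exact: (Bt i I).
Qed.

Section bilinear.
Context (R : realType) (m : nat).
Implicit Types x y : 'euc[R]_m.

Definition colv x : 'cV[R]_m := \col_i (tnth x i : R).

(* x^t M y, as the only entry of a 1 x 1 matrix *)
Definition bilin (M : 'M[R]_m) x y : R :=
  ((colv x)^T *m M *m colv y) ord0 ord0.

Definition tadd x y : 'euc[R]_m :=
  [tuple (tnth x i + tnth y i : R) | i < m].

Definition topp x : 'euc[R]_m := [tuple (- tnth x i : R) | i < m].

Lemma measurable_bilin_diag (M : 'M[R]_m) :
  measurable_fun [set: 'euc[R]_m] (fun y => bilin M y y).
Proof.
rewrite (_ : (fun y => _) =
    fun y => \sum_j (\sum_i (tnth y i : R) * M i j) * (tnth y j : R)).
  apply: measurable_sum => j; apply: measurable_funM; last first.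
    exact: measurable_tnth.
  apply: measurable_sum => i; apply: measurable_funM => //.
  exact: measurable_tnth.
apply/funext => y; rewrite /bilin mxE; apply: eq_bigr => j _.
by rewrite !mxE; congr (_ * _); apply: eq_bigr => i _; rewrite !mxE.
Qed.

End bilinear.

Definition sympl_mx (R : realType) (n : nat) : 'M[R]_(n + n) :=
  block_mx 0 1%:M (- 1%:M) 0.

Notation "'heis[ R ]_ n" := ('euc[R]_(n + n) * measurableTypeR R)%type
  (at level 0, n at level 2, format "''heis[' R ]_ n").

Section heisenberg.
Context (R : realType) (n : nat).
Implicit Types z w : 'heis[R]_n.

Definition hmul z w : 'heis[R]_n :=
  (tadd z.1 w.1, (z.2 : R) + (w.2 : R) + bilin (sympl_mx R n) z.1 w.1).

Definition hinv z : 'heis[R]_n := (topp z.1, - (z.2 : R)).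

Definition haar : set 'heis[R]_n -> \bar R :=
  (@lebesgue_tuple R (n + n) \x @lebesgue_measure R)%E.

HB.instance Definition _ := Measure.copy haar
  (@lebesgue_tuple R (n + n) \x @lebesgue_measure R)%E.

HB.instance Definition _ := Measure_isSigmaFinite.Build _ _ _ haar
  (product_measure1_sigma_finite (@lebesgue_tuple R (n + n))
     (@lebesgue_measure R)).

End heisenberg.

(* Complex functions are handled through their real and imaginary parts, the
   library having no integral and no sigma-algebra for R[i]. *)

Section complex_functions.
Context d (T : measurableType d) (R : realType).
Implicit Types (mu : {measure set T -> \bar R}) (f : T -> R[i]).

Definition cmeasurable f :=
  measurable_fun [set: T] (fun x => complex.Re (f x)) /\
  measurable_fun [set: T] (fun x => complex.Im (f x)).

Definition cintegrable mu f :=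
  mu.-integrable setT (fun x => (complex.Re (f x))%:E) /\
  mu.-integrable setT (fun x => (complex.Im (f x))%:E).

Definition cintegral mu f : R[i] :=
  Complex (\int[mu]_x complex.Re (f x)) (\int[mu]_x complex.Im (f x)).

Definition cLnorm mu (p : \bar R) f : \bar R :=
  Lnorm mu p (fun x => (ComplexField.Normc.normc (f x))%:E).

End complex_functions.

Section convolution.
Context (R : realType) (n : nat).
Variable mu : {measure set 'heis[R]_n -> \bar R}.
Implicit Types (f : 'heis[R]_n -> R[i]) (z : 'heis[R]_n).

Definition hconv_integrable f z :=
  cintegrable mu (fun w => f (hmul z (hinv w))).

(* meaningful at z when [hconv_integrable f z] *)
Definition hconv f z : R[i] :=
  cintegral mu (fun w => f (hmul z (hinv w))).

(* The measurability of [hconv f] is part of its membership in L^q: the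
   library's norm is total and means nothing on a nonmeasurable function. *)
Definition hconv_bounded (p q : \bar R) :=
  exists c : R, forall f : 'heis[R]_n -> R[i],
    cmeasurable f -> (cLnorm (@haar R n) p f < +oo)%E ->
    [/\ {ae @haar R n, forall z, hconv_integrable f z},
        cmeasurable (hconv f) &
        (cLnorm (@haar R n) q (hconv f) <= c%:E * cLnorm (@haar R n) p f)%E].

End convolution.

Section graph_measure.
Context (R : realType) (n : nat) (A : 'M[R]_(n + n)).

Definition graph_pt (y : 'euc[R]_(n + n)) : 'heis[R]_n := (y, bilin A y y).

Definition mu_quad (E : set 'heis[R]_n) : \bar R :=
  (\int[@lebesgue_tuple R (n + n)]_y (\1_E (graph_pt y))%:E)%E.

Lemma measurable_graph_pt : measurable_fun [set: 'euc[R]_(n + n)] graph_pt.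
Proof. by apply: measurable_fun_pair => //; exact: measurable_bilin_diag. Qed.

Lemma measurable_graph_pt_preimage (E : set 'heis[R]_n) :
  measurable E -> measurable (graph_pt @^-1` E).
Proof.
by move=> mE; rewrite -[X in measurable X]setTI; exact: measurable_graph_pt.
Qed.

Lemma mu_quadE (E : set 'heis[R]_n) : measurable E ->
  mu_quad E = pushforward (@lebesgue_tuple R (n + n)) graph_pt E.
Proof.
move=> mE; rewrite /mu_quad /pushforward.
have mgE := measurable_graph_pt_preimage mE.
by rewrite -[X in _ = lebesgue_tuple X]setIT -integral_indic.
Qed.

Let mu_quad0 : mu_quad set0 = 0%E.
Proof. by rewrite mu_quadE // /pushforward preimage_set0 measure0. Qed.

Let mu_quad_ge0 E : (0 <= mu_quad E)%E.
Proof. by apply: integral_ge0 => y _; rewrite lee_fin. Qed.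

Let mu_quad_sigma_additive : semi_sigma_additive mu_quad.
Proof.
move=> F mF tF mUF; rewrite mu_quadE // /pushforward preimage_bigcup.
under eq_fun do under eq_bigr do rewrite mu_quadE //.
apply: measure_semi_sigma_additive.
- by move=> k; exact: measurable_graph_pt_preimage.
- apply/trivIsetP => /= i j _ _ ij; rewrite -preimage_setI.
  by move/trivIsetP : tF => /(_ _ _ _ _ ij) ->//; rewrite preimage_set0.
- by rewrite -preimage_bigcup; exact: measurable_graph_pt_preimage.
Qed.

HB.instance Definition _ := isMeasure.Build _ _ _ mu_quad
  mu_quad0 mu_quad_ge0 mu_quad_sigma_additive.

Let mu_quad_sigma_finite : sigma_finite setT mu_quad.
Proof.
have [F FT Foo] : sigma_finite setT (@lebesgue_tuple R (n + n)).
  exact: sigma_finiteT.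
exists (fun k => F k `*` setT); first by rewrite -setX_bigcupl -FT setXTT.
move=> k; have [mF Fk] := Foo k.
have mFT : measurable (F k `*` [set: measurableTypeR R]) by exact: measurableX.
split=> //; rewrite mu_quadE // /pushforward.
by rewrite (_ : _ @^-1` _ = F k) //; apply/seteqP; split=> y //= [].
Qed.

HB.instance Definition _ := Measure_isSigmaFinite.Build _ _ _ mu_quad
  mu_quad_sigma_finite.

End graph_measure.

(* For symmetric A the two sign choices in det (2A +- J) agree. *)
Lemma det_sympl_sign (R : realType) (n : nat) (A : 'M[R]_(n + n)) :
  A^T = A ->
  \det (2%:R *: A - sympl_mx R n) = \det (2%:R *: A + sympl_mx R n).
Proof.
move=> AT; rewrite -det_tr; congr (\det _).
rewrite !linearD /= linearN /= linearZ /= AT; congr (_ + _).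
rewrite /sympl_mx tr_block_mx !linearN /= !trmx0 trmx1 opp_block_mx.
by rewrite !oppr0 opprK.
Qed.

(* Main.v *)
Require Import Defs.
From mathcomp Require Import all_boot all_order all_algebra.
From mathcomp Require Import all_classical all_reals all_analysis.
From mathcomp Require Import measurable_realfun complex ring lra.

(** The convolution with the measure carried by the graph of the quadratic form
    phi(y) = y^t A y is
      T f (x, t) = int f (x - y, t - phi(y) - <x, y>) dy.
    Put w = x - y. The phase becomes - phi(x) - phi(w) + x^t (2A + J) w, so
    that, up to the shears t -> t - phi(x) and s -> s - phi(w), which preserve
    Haar measure, and up to the change of variables v = (2A + J) w, which is
    where the determinant condition enters, |T f| is dominated by
      S g (x, t) = int g (v, t + x . v) dv,   x, v in R^m, m = 2n,
    that is, by the integrals of a nonnegative function over the non-vertical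
    hyperplanes of R^(m+1). It remains to bound this Radon transform, a
    positive operator, from L^p to L^q for q = m + 2 and p = q / (q - 1).

    The Radon transform in m variables is the composition of m transforms in
    one variable, each acting on one coordinate of v and on t. The exponent in
    t moves by 1 / q at each of these steps: with the mixed norms L^r_v L^a_t,
    the one-variable transform maps
      L^p_v L^(q / (k + 1))_t   to   L^q_x L^(q / k)_t,   1 <= k <= q - 2.
    Starting from q / (m + 1) = p and ending at q / 1 = q, the m steps k = m,
    ..., 1 give the theorem. Since p <= q, the integral form of Minkowski's
    inequality puts the mixed norms in the right order between two steps
    ([radon_mixed]).

    One step, for 2 k <= q ([radon1_bound_direct]): write (S g)^2 as a double
    integral over (v, w) and apply Minkowski's inequality in t and then in x.
    For fixed v and w there remains the correlation of two functions of t at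
    the lag x (w - v). Young's inequality bounds its norm in the lag
    ([young_correlation]), the dilation x -> x (w - v) yields the kernel
    |w-v|^(-2/q), and the diagonal case of the Hardy-Littlewood-Sobolev
    inequality concludes ([hardy_littlewood_sobolev]). For 2 k > q the step is
    the adjoint of the step for q - 1 - k ([radon1_bound_dual]). *)

Set Implicit Arguments.
Unset Strict Implicit.
Unset Printing Implicit Defensive.

Import Order.TTheory GRing.Theory Num.Theory.
Import numFieldNormedType.Exports.
Local Open Scope classical_set_scope.
Local Open Scope ring_scope.
Local Open Scope ereal_scope.

(** * Nonnegative measurable functions *)

(** All integrals below are of such functions: the two conditions are what
    Tonelli's theorem and the monotonicity of the integral ask for, and they
    are stable under all the operations that the proof performs. *)
Definition mnn (R : realType) d (T : measurableType d) (f : T -> \bar R) :=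
  measurable_fun [set: T] f /\ forall x, 0 <= f x.

Section mnn_theory.
Context {R : realType}.

Lemma mnn_ge0 d (T : measurableType d) (f : T -> \bar R) x : mnn f -> 0 <= f x.
Proof. by case=> _; exact. Qed.

Lemma mnn_cst d (T : measurableType d) (c : \bar R) :
  0 <= c -> mnn (fun _ : T => c).
Proof. by move=> c0; split. Qed.

Lemma mnn_comp1 d1 d2 (X : measurableType d1) (T : measurableType d2)
    (g : T -> \bar R) (a : X -> T) :
  mnn g -> measurable_fun setT a -> mnn (fun x => g (a x)).
Proof. by move=> [mg g0] ma; split=> //; exact: measurableT_comp. Qed.

Lemma mnn_comp2 d d1 d2 (X : measurableType d) (T1 : measurableType d1)
    (T2 : measurableType d2) (g : T1 -> T2 -> \bar R)
    (a : X -> T1) (b : X -> T2) :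
  mnn (fun p : T1 * T2 => g p.1 p.2) ->
  measurable_fun setT a -> measurable_fun setT b ->
    mnn (fun x => g (a x) (b x)).
Proof.
move=> [mg g0] ma mb; split; last by move=> x; exact: (g0 (a x, b x)).
exact: (measurableT_comp mg (measurable_fun_pair ma mb)).
Qed.

Lemma mnn_comp3 d d1 d2 d3 (X : measurableType d) (T1 : measurableType d1)
    (T2 : measurableType d2) (T3 : measurableType d3)
    (g : T1 -> T2 -> T3 -> \bar R) (a : X -> T1) (b : X -> T2) (c : X -> T3) :
  mnn (fun p : T1 * T2 * T3 => g p.1.1 p.1.2 p.2) ->
  measurable_fun setT a -> measurable_fun setT b -> measurable_fun setT c ->
  mnn (fun x => g (a x) (b x) (c x)).
Proof.
move=> [mg g0] ma mb mc; split; last by move=> x; exact: (g0 (a x, b x, c x)).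
exact: (measurableT_comp mg
  (measurable_fun_pair (measurable_fun_pair ma mb) mc)).
Qed.

Lemma mnnM d (T : measurableType d) (f g : T -> \bar R) :
  mnn f -> mnn g -> mnn (fun x => f x * g x).
Proof.
move=> [mf f0] [mg g0]; split; first exact: emeasurable_funM.
by move=> x; exact: mule_ge0.
Qed.

Lemma mnnD d (T : measurableType d) (f g : T -> \bar R) :
  mnn f -> mnn g -> mnn (fun x => f x + g x).
Proof.
move=> [mf f0] [mg g0]; split; first exact: emeasurable_funD.
by move=> x; exact: adde_ge0.
Qed.

Lemma mnnX d (T : measurableType d) (f : T -> \bar R) r :
  mnn f -> mnn (fun x => f x `^ r).
Proof.
move=> [mf f0]; split; last by move=> x; exact: poweR_ge0.
by apply: (measurableT_comp (measurable_poweR r)).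
Qed.

Lemma mnn_EFin d (T : measurableType d) (f : T -> R) :
  measurable_fun setT f -> (forall x, (0 <= f x)%R) -> mnn (fun x => (f x)%:E).
Proof. by move=> mf f0; split=> [|x];
  [exact/measurable_EFinP|rewrite lee_fin]. Qed.

Lemma mnn_powR d (T : measurableType d) (f : T -> R) r :
  measurable_fun setT f -> mnn (fun x => (f x `^ r)%:E).
Proof.
move=> mf; apply: mnn_EFin; last by move=> x; exact: powR_ge0.
exact: (measurableT_comp (measurable_powR r)).
Qed.

Lemma mnn_int d1 d2 (X : measurableType d1) (Y : measurableType d2)
    (m : {sigma_finite_measure set Y -> \bar R}) (f : X -> Y -> \bar R) :
  mnn (fun p : X * Y => f p.1 p.2) -> mnn (fun x => \int[m]_y f x y).
Proof.
move=> [mf f0]; split.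
  exact: (measurable_fun_fubini_tonelli_F (fun p : X * Y => f p.1 p.2)).
by move=> x; apply: integral_ge0 => y _; exact: (f0 (x, y)).
Qed.

Lemma mnn_if d (T : measurableType d) (b : T -> bool) (f g : T -> \bar R) :
  measurable_fun setT b -> mnn f -> mnn g ->
  mnn (fun x => if b x then f x else g x).
Proof.
move=> mb [mf f0] [mg g0]; split; first exact: measurable_fun_ifT.
by move=> x; case: ifP.
Qed.

Lemma tonelli d1 d2 (X : measurableType d1) (Y : measurableType d2)
    (m1 : {sigma_finite_measure set X -> \bar R})
    (m2 : {sigma_finite_measure set Y -> \bar R}) (f : X -> Y -> \bar R) :
  mnn (fun p : X * Y => f p.1 p.2) ->
  \int[m1]_x \int[m2]_y f x y = \int[m2]_y \int[m1]_x f x y.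
Proof.
by move=> [mf f0]; exact: (fubini_tonelli (fun p : X * Y => f p.1 p.2)).
Qed.

Lemma le_int d (T : measurableType d) (mu : {measure set T -> \bar R})
    (f g : T -> \bar R) :
  mnn f -> mnn g -> (forall x, f x <= g x) -> \int[mu]_x f x <= \int[mu]_x g x.
Proof. by move=> [mf f0] [mg g0] fg; exact: ge0_le_integral. Qed.

Lemma ae_le_int d (T : measurableType d) (mu : {measure set T -> \bar R})
    (f g : T -> \bar R) :
  mnn f -> mnn g -> {ae mu, forall x, f x <= g x} ->
  \int[mu]_x f x <= \int[mu]_x g x.
Proof.
move=> [mf f0] [mg g0] fg; apply: ae_ge0_le_integral => //.
by apply: filterS fg => x fgx _.
Qed.

Lemma intZl d (T : measurableType d) (mu : {measure set T -> \bar R})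
    (f : T -> \bar R) k :
  mnn f -> 0 <= k -> \int[mu]_x (k * f x) = k * \int[mu]_x f x.
Proof. by move=> [mf f0] k0; rewrite ge0_integralZl. Qed.

Lemma intZr d (T : measurableType d) (mu : {measure set T -> \bar R})
    (f : T -> \bar R) k :
  mnn f -> 0 <= k -> \int[mu]_x (f x * k) = \int[mu]_x f x * k.
Proof. by move=> [mf f0] k0; rewrite ge0_integralZr. Qed.

Lemma intD d (T : measurableType d) (mu : {measure set T -> \bar R})
    (f g : T -> \bar R) : mnn f -> mnn g ->
  \int[mu]_x (f x + g x) = \int[mu]_x f x + \int[mu]_x g x.
Proof. by move=> [mf f0] [mg g0]; rewrite ge0_integralD. Qed.

Lemma int0_ae d (T : measurableType d) (mu : {measure set T -> \bar R})
    (f : T -> \bar R) :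
  mnn f -> \int[mu]_x f x = 0 -> {ae mu, forall x, f x = 0}.
Proof.
move=> [mf f0] If0.
have : \int[mu]_x `|f x| = 0.
  by rewrite -{}If0; apply: eq_integral => x _; rewrite gee0_abs.
move/(ae_eq_integral_abs mu measurableT mf).
by apply: filterS => x /= /(_ I).
Qed.

Lemma ae_int0 d (T : measurableType d) (mu : {measure set T -> \bar R})
    (f : T -> \bar R) :
  mnn f -> {ae mu, forall x, f x = 0} -> \int[mu]_x f x = 0.
Proof.
move=> [mf f0] fae.
rewrite (@ge0_ae_eq_integral _ _ _ mu setT f (cst 0)) ?integral0//.
by apply: filterS fae => x fx0 _.
Qed.

Lemma int_lty_ae d (T : measurableType d) (mu : {measure set T -> \bar R})
    (f : T -> \bar R) :
  mnn f -> \int[mu]_x f x < +oo -> {ae mu, forall x, f x < +oo}.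
Proof.
move=> [mf f0] Ify.
have fi : mu.-integrable setT f.
  apply/integrableP; split=> //.
  by under eq_integral do rewrite gee0_abs//.
apply: filterS (integrable_ae measurableT fi) => x /(_ I).
by rewrite ge0_fin_numE.
Qed.

End mnn_theory.

Lemma measurable_fst_comp d d1 d2 (T : measurableType d) (T1 : measurableType
  d1)
  (T2 : measurableType d2) (h : T -> T1 * T2) :
  measurable_fun setT h -> measurable_fun setT (fun x => (h x).1).
Proof. by move=> mh; exact: (measurableT_comp measurable_fst mh). Qed.

Lemma measurable_snd_comp d d1 d2 (T : measurableType d) (T1 : measurableType
  d1)
  (T2 : measurableType d2) (h : T -> T1 * T2) :
  measurable_fun setT h -> measurable_fun setT (fun x => (h x).2).
Proof. by move=> mh; exact: (measurableT_comp measurable_snd mh). Qed.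

Lemma measurable_norm_comp (R : realType) d (T : measurableType d) (h : T ->
  R) :
  measurable_fun setT h -> measurable_fun setT (fun x => `|h x|%R).
Proof. by move=> mh; apply: (measurableT_comp (@normr_measurable R setT) mh).
  Qed.

Lemma measurable_opp_comp (R : realType) d (T : measurableType d) (h : T -> R) :
  measurable_fun setT h -> measurable_fun setT (fun x => (- h x)%R).
Proof. by move=> mh; apply: (measurableT_comp (@oppr_measurable R setT) mh).
  Qed.

Section tuple_measurability.
Context {R : realType} d (X : measurableType d).

Definition dot m (x v : 'euc[R]_m) : R :=
  (\sum_(i < m) (tnth x i : R) * (tnth v i : R))%R.

Lemma measurable_tnth_comp m (h : X -> 'euc[R]_m) (i : 'I_m) :
  measurable_fun setT h -> measurable_fun setT (fun x => tnth (h x) i : R).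
Proof.
by move=> mh; exact: (measurableT_comp (@measurable_tnth _ (measurableTypeR R)
  m i) mh).
Qed.

Lemma measurable_cons_pair_comp m (a : X -> measurableTypeR R)
    (h : X -> 'euc[R]_m) : measurable_fun setT a -> measurable_fun setT h ->
  measurable_fun setT (fun x => cons_pair (a x, h x)).
Proof.
move=> ma mh; apply: (measurableT_comp (@measurable_cons_pair R m)).
exact: measurable_fun_pair.
Qed.

Lemma measurable_dot_comp m (a b : X -> 'euc[R]_m) :
  measurable_fun setT a -> measurable_fun setT b ->
  measurable_fun setT (fun x => dot (a x) (b x)).
Proof.
move=> ma mb; apply: measurable_sum => i; apply: measurable_funM.
  exact: measurable_tnth_comp.
exact: measurable_tnth_comp.
Qed.

Lemma measurable_tuple_comp m (h : 'I_m -> X -> measurableTypeR R) :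
  (forall i, measurable_fun setT (h i)) ->
  measurable_fun setT (fun x => [tuple h i x | i < m] : 'euc[R]_m).
Proof.
move=> mh; apply/measurable_fun_tnthP => i.
by rewrite (_ : _ \o _ = h i)//; apply/funext => x /=; rewrite tnth_mktuple.
Qed.

Lemma measurable_tadd_comp m (a b : X -> 'euc[R]_m) :
  measurable_fun setT a -> measurable_fun setT b ->
  measurable_fun setT (fun x => tadd (a x) (b x)).
Proof.
by move=> ma mb; apply: measurable_tuple_comp => i; apply: measurable_funD;
  exact: measurable_tnth_comp.
Qed.

Lemma measurable_topp_comp m (a : X -> 'euc[R]_m) :
  measurable_fun setT a -> measurable_fun setT (fun x => topp (a x)).
Proof.
move=> ma; apply: measurable_tuple_comp => i; apply: measurable_opp_comp.
exact: measurable_tnth_comp.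
Qed.

Definition tupv m (u : 'cV[R]_m) : 'euc[R]_m := [tuple (u i ord0 : R) | i < m].

Definition mulv m (M : 'M[R]_m) (x : 'euc[R]_m) : 'euc[R]_m :=
  tupv (M *m colv x).

Lemma measurable_mulv_comp m (M : 'M[R]_m) (a : X -> 'euc[R]_m) :
  measurable_fun setT a -> measurable_fun setT (fun x => mulv M (a x)).
Proof.
move=> ma; apply: measurable_tuple_comp => i.
rewrite (_ : (fun _ => _) =
  fun x => (\sum_j M i j * (tnth (a x) j : R))%R); last first.
  by apply/funext => x; rewrite mxE; apply: eq_bigr => j _; rewrite mxE.
apply: measurable_sum => j; apply: measurable_funM => //.
exact: measurable_tnth_comp.
Qed.

Lemma bilinE m (M : 'M[R]_m) (x y : 'euc[R]_m) : bilin M x y = dot x (mulv M y).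
Proof.
rewrite /bilin -mulmxA mxE; apply: eq_bigr => i _.
by rewrite tnth_mktuple !mxE.
Qed.

Lemma measurable_bilin_comp m (M : 'M[R]_m) (a b : X -> 'euc[R]_m) :
  measurable_fun setT a -> measurable_fun setT b ->
  measurable_fun setT (fun x => bilin M (a x) (b x)).
Proof.
move=> ma mb; under eq_fun do rewrite bilinE.
by apply: measurable_dot_comp => //; exact: measurable_mulv_comp.
Qed.

End tuple_measurability.

(** The two tactics that follow descend along the syntax of the function. They
    compare hypotheses and goals syntactically, since trying to unify two
    different integrands unfolds them. *)
Ltac solve_meas :=
  cbv beta;
  lazymatch goal with
  | |- measurable_fun _ (fun z => _) => idtac
  | |- measurable_fun ?D ?f => change (measurable_fun D (fun z => f z))
  end;
  first
  [ exact: measurable_cst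
  | lazymatch goal with
    | |- measurable_fun _ (fun z => z) => exact: measurable_id
    | |- measurable_fun _ (fun z => fst (@?h z)) =>
        apply: measurable_fst_comp; solve_meas
    | |- measurable_fun _ (fun z => snd (@?h z)) =>
        apply: measurable_snd_comp; solve_meas
    | |- measurable_fun _ (fun z => cons_pair (@?a z, @?b z)) =>
        apply: measurable_cons_pair_comp; [solve_meas|solve_meas]
    | |- measurable_fun _ (fun z => tadd (@?a z) (@?b z)) =>
        apply: measurable_tadd_comp; [solve_meas|solve_meas]
    | |- measurable_fun _ (fun z => topp (@?a z)) =>
        apply: measurable_topp_comp; solve_meas
    | |- measurable_fun _ (fun z => mulv _ (@?a z)) =>
        apply: measurable_mulv_comp; solve_meas
    | |- measurable_fun _ (fun z => bilin _ (@?a z) (@?b z)) =>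
        apply: measurable_bilin_comp; [solve_meas|solve_meas]
    | |- measurable_fun _ (fun z => dot (@?a z) (@?b z)) =>
        apply: measurable_dot_comp; [solve_meas|solve_meas]
    | |- measurable_fun _ (fun z => tnth (@?a z) _) =>
        apply: measurable_tnth_comp; solve_meas
    | |- measurable_fun _ (fun z => (@?a z, @?b z)) =>
        apply: measurable_fun_pair; [solve_meas|solve_meas]
    | |- measurable_fun _ (fun z => (- @?a z)%R) =>
        apply: measurable_opp_comp; solve_meas
    | |- measurable_fun _ (fun z => (@?a z + @?b z)%R) =>
        apply: measurable_funD; [solve_meas|solve_meas]
    | |- measurable_fun _ (fun z => (@?a z * @?b z)%R) =>
        apply: measurable_funM; [solve_meas|solve_meas]
    | |- measurable_fun _ (fun z => `|@?a z|%R) =>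
        apply: measurable_norm_comp; solve_meas
    | |- measurable_fun _ (fun z => (@?a z <= @?b z)%R) =>
        apply: measurable_fun_ler; [solve_meas|solve_meas]
    | |- measurable_fun _ (fun z => (@?a z < @?b z)%R) =>
        apply: measurable_fun_ltr; [solve_meas|solve_meas]
    end
  | assumption
  ].

Ltac solve_mnn :=
  cbv beta;
  first
  [ lazymatch goal with
    | |- mnn (fun z => poweR (@?f z) ?r) => apply: mnnX; solve_mnn
    | |- mnn (fun z => mule (@?f z) (@?g z)) => apply: mnnM;
      [solve_mnn|solve_mnn]
    | |- mnn (fun z => adde (@?f z) (@?g z)) => apply: mnnD;
      [solve_mnn|solve_mnn]
    | |- mnn (fun z => integral _ _ _) => apply: mnn_int; solve_mnn
    | |- mnn (fun z => if _ then _ else _) =>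
        apply: mnn_if; [solve_meas|solve_mnn|solve_mnn]
    | |- mnn (fun z => EFin (powR _ _)) => apply: mnn_powR; solve_meas
    end
  | match goal with
    | H : mnn ?g |- mnn ?g' => constr_eq g g'; exact: H
    end
  | match goal with
    | H : mnn (fun p => ?g p.1 p.2) |- mnn (fun z => ?g' (@?a z) (@?b z)) =>
        constr_eq g g';
        apply: (mnn_comp2 (a := a) (b := b) H); [solve_meas|solve_meas]
    | H : mnn (fun p => ?g p.1.1 p.1.2 p.2)
        |- mnn (fun z => ?g' (@?a z) (@?b z) (@?c z)) =>
        constr_eq g g';
        apply: (mnn_comp3 (a := a) (b := b) (c := c) H);
          [solve_meas|solve_meas|solve_meas]
    | H : mnn (fun p => ?g p.1 p.2) |- mnn (?g' ?u) =>
        constr_eq g g';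
        refine (mnn_comp2 (a := fun _ => u) (b := fun z => z) H _ _);
          [solve_meas|solve_meas]
    | H : mnn (fun p => ?g p.1.1 p.1.2 p.2) |- mnn (?g' ?u ?v) =>
        constr_eq g g';
        refine (mnn_comp3 (a := fun _ => u) (b := fun _ => v) (c := fun z => z)
          H _ _ _); [solve_meas|solve_meas|solve_meas]
    | H : mnn ?g |- mnn (fun z => ?g' (@?a z)) =>
        constr_eq g g';
        apply: (mnn_comp1 (a := a) H); solve_meas
    end
  | (apply: mnn_cst; solve [by []|assumption|apply: poweR_ge0|
       apply: integral_ge0 => ? _; by []])
  ].

(** * Powers, and the inequalities of Hoelder and Minkowski *)
Section poweR_extra.
Context {R : realType}.
Implicit Types (x y : \bar R) (r s : R).

Lemma poweRD_ge0 x r s : (0 <= r)%R -> (0 <= s)%R ->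
  x `^ (r + s) = x `^ r * x `^ s.
Proof.
move=> r0 s0; have [->|rN0] := eqVneq r 0%R;
  first by rewrite add0r poweRe0 mul1e.
by apply: poweRD; apply: add_neq0_poweRD_def;
  rewrite gt_eqF// ltr_wpDr// lt0r rN0.
Qed.

Lemma le_poweR x y r : (0 <= r)%R -> 0 <= x -> x <= y -> x `^ r <= y `^ r.
Proof.
move=> r0 x0 xy; apply: gt0_ler_poweR => //; rewrite in_itv/= leey andbT//.
exact: le_trans xy.
Qed.

Lemma poweRK x r : (r != 0)%R -> 0 <= x -> (x `^ r) `^ r^-1 = x.
Proof. by move=> r0 x0; rewrite -poweRrM divff// poweRe1. Qed.

Lemma poweRVK x r : (r != 0)%R -> 0 <= x -> (x `^ r^-1) `^ r = x.
Proof. by move=> r0 x0; rewrite -poweRrM mulVf// poweRe1. Qed.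

Lemma poweR_sqr x : 0 <= x -> x `^ 2 = x * x.
Proof.
move=> x0; rewrite (_ : 2 = 1 + 1 :> R)%R; last by rewrite -natr1.
by rewrite poweRD_ge0 ?ler01// poweRe1.
Qed.

End poweR_extra.

Section hoelder_geometric.
Context {R : realType} d (T : measurableType d).
Variable mu : {measure set T -> \bar R}.

Lemma weighted_agm (a b : R) (x y : R) : (0 < a -> 0 < b -> a + b = 1 ->
  0 <= x -> 0 <= y -> x `^ a * y `^ b <= a * x + b * y)%R.
Proof.
move=> a0 b0 ab x0 y0.
have := @conjugate_powR R (x `^ a)%R (y `^ b)%R a^-1%R b^-1%R (powR_ge0 _ _)
  (powR_ge0 _ _).
rewrite !invrK -!powRrM !divff ?gt_eqF// !powRr1// ![(_ * a)%R]mulrC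
  ![(_ * b)%R]mulrC.
by apply => //; rewrite invr_gt0.
Qed.

(** Hoelder's inequality, with the exponents outside of the functions. In this
    form the exponents a and b are only required to be nonnegative, and the
    inequality can be applied repeatedly without roots piling up. After
    normalizing both integrals it is the pointwise weighted AM-GM inequality. *)
Lemma hoelder_geometric (f g : T -> \bar R) (a b : R) :
  mnn f -> mnn g -> (0 <= a)%R -> (0 <= b)%R -> (a + b = 1)%R ->
  \int[mu]_x (f x `^ a * g x `^ b) <=
  (\int[mu]_x f x) `^ a * (\int[mu]_x g x) `^ b.
Proof.
move=> mf mg; rewrite le_eqVlt => /predU1P[<- _|a0].
  rewrite add0r => ->; rewrite poweRe0 mul1e poweRe1; last first.
    by apply: integral_ge0 => x _; exact: mnn_ge0 mg.
  rewrite le_eqVlt; apply/orP; left; apply/eqP; apply: eq_integral => x _.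
  by rewrite poweRe0 mul1e poweRe1//; exact: mnn_ge0 mg.
rewrite le_eqVlt => /predU1P[<-|b0 ab].
  rewrite addr0 => ->; rewrite poweRe0 mule1 poweRe1; last first.
    by apply: integral_ge0 => x _; exact: mnn_ge0 mf.
  rewrite le_eqVlt; apply/orP; left; apply/eqP; apply: eq_integral => x _.
  by rewrite poweRe0 mule1 poweRe1//; exact: mnn_ge0 mf.
have mF : mnn (fun x => f x `^ a * g x `^ b) by solve_mnn.
have If0 : 0 <= \int[mu]_x f x.
  by apply: integral_ge0 => x _; exact: mnn_ge0 mf.
have Ig0 : 0 <= \int[mu]_x g x.
  by apply: integral_ge0 => x _; exact: mnn_ge0 mg.
have [f0|fN0] := eqVneq (\int[mu]_x f x) 0.
  rewrite f0 poweR0r ?gt_eqF// mul0e ae_int0//.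
  by apply: filterS (int0_ae mf f0) => x ->; rewrite poweR0r ?gt_eqF// mul0e.
have [g0|gN0] := eqVneq (\int[mu]_x g x) 0.
  rewrite g0 (poweR0r (r := b)) ?gt_eqF// mule0 ae_int0//.
  by apply: filterS (int0_ae mg g0) => x ->;
    rewrite (poweR0r (r := b)) ?gt_eqF// mule0.
have [fy|fy] := eqVneq (\int[mu]_x f x) +oo.
  rewrite fy poweRyr ?gt_eqF// gt0_mulye ?leey//.
  by rewrite poweR_gt0// lt0e gN0.
have [gy|gy] := eqVneq (\int[mu]_x g x) +oo.
  rewrite gy (poweRyr (r := b)) ?gt_eqF// gt0_muley ?leey//.
  by rewrite poweR_gt0// lt0e fN0.
move: If0 Ig0 fN0 gN0 fy gy.
case Ef : (\int[mu]_x f x) => [A| |]//; case Eg : (\int[mu]_x g x) => [B| |]//.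
rewrite !lee_fin !eqe => A0 B0 AN0 BN0 _ _.
have {AN0}A0 : (0 < A)%R by rewrite lt0r AN0.
have {BN0}B0 : (0 < B)%R by rewrite lt0r BN0.
have c0 : (0 <= A `^ a * B `^ b)%R by rewrite mulr_ge0// powR_ge0.
have aA0 : (0 <= a / A)%R by rewrite divr_ge0// ltW.
have bB0 : (0 <= b / B)%R by rewrite divr_ge0// ltW.
pose F x := (A `^ a * B `^ b)%:E * ((a / A)%:E * f x + (b / B)%:E * g x).
have mG : mnn (fun x => (a / A)%:E * f x + (b / B)%:E * g x).
  by apply: mnnD; apply: mnnM => //; apply: mnn_cst; rewrite lee_fin.
apply: (@le_trans _ _ (\int[mu]_x F x)).
  apply: le_int => //; first by apply: mnnM => //; apply: mnn_cst;
    rewrite lee_fin.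
  move=> x; rewrite /F; have := mnn_ge0 x mf; have := mnn_ge0 x mg.
  have aA : (0 < a / A)%R by rewrite divr_gt0.
  have bB : (0 < b / B)%R by rewrite divr_gt0.
  have cc : (0 < A `^ a * B `^ b)%R by rewrite mulr_gt0// powR_gt0.
  case: (f x) => [u| |]//; case: (g x) => [v| |]// v0 u0.
  - rewrite !poweR_EFin -!EFinM. rewrite lee_fin.
    rewrite !lee_fin in u0 v0.
    have -> : (u `^ a * v `^ b = A `^ a * B `^ b *
        ((u / A) `^ a * (v / B) `^ b))%R.
      rewrite -[in LHS](divfK (lt0r_neq0 A0) u) -[in LHS](divfK (lt0r_neq0 B0)
        v).
      rewrite (powRM a (divr_ge0 u0 (ltW A0)) (ltW A0)).
      by rewrite (powRM b (divr_ge0 v0 (ltW B0)) (ltW B0)); ring.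
    rewrite -mulrA mulrA ler_pM2l//.
    have := @weighted_agm a b (u / A) (v / B) a0 b0 ab.
    rewrite !divr_ge0// ?(ltW A0)// ?(ltW B0)// => /(_ isT isT).
    by rewrite mulrAC -[(b / B * v)%R]mulrAC !mulrA.
  - rewrite (gt0_muley (x := (b / B)%:E)) ?lte_fin// addey//.
      by rewrite gt0_muley ?lte_fin// leey.
  - by rewrite gt0_muley ?lte_fin// addye// gt0_muley ?lte_fin// leey.
  - rewrite (gt0_muley (x := (a / A)%:E)) ?lte_fin// (gt0_muley (x :=
    (b / B)%:E)) ?lte_fin//.
    by rewrite addye// gt0_muley ?lte_fin// leey.
rewrite /F intZl ?lee_fin// !poweR_EFin -EFinM.
rewrite intD; last 2 first.
- by apply: mnnM => //; apply: mnn_cst; rewrite lee_fin.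
- by apply: mnnM => //; apply: mnn_cst; rewrite lee_fin.
rewrite !intZl ?lee_fin// Ef Eg -!EFinM lee_fin.
by rewrite !divfK ?gt_eqF// ab mulr1.
Qed.

End hoelder_geometric.

Section minkowski.
Context {R : realType} d1 d2 (X : measurableType d1) (Y : measurableType d2).
Variable m1 : {sigma_finite_measure set X -> \bar R}.
Variable m2 : {sigma_finite_measure set Y -> \bar R}.

(** Let N(y) be the norm of F(., y). Hoelder's inequality with respect to the
    measure N(y) dy bounds (int F dy)^r by
      (int F^r N^(1-r) dy) (int N dy)^(r-1),
    and the integral over x of the first factor is int N dy. This is rigorous
    where N is positive and finite; where N(y) = 0, the function F(., y)
    vanishes almost everywhere, and this set of y is discarded with Tonelli's
    theorem. *)
Lemma minkowski_integral (F : X -> Y -> \bar R) (r : R) :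
  mnn (fun p : X * Y => F p.1 p.2) -> (1 <= r)%R ->
  \int[m1]_x (\int[m2]_y F x y) `^ r <=
  (\int[m2]_y (\int[m1]_x F x y `^ r) `^ r^-1) `^ r.
Proof.
move=> mF r1.
have r0 : (0 < r)%R by exact: lt_le_trans r1.
have rN0 : r != 0%R by rewrite gt_eqF.
have r10 : (0 <= r - 1)%R by rewrite subr_ge0.
pose N y := (\int[m1]_x F x y `^ r) `^ r^-1.
have mN : mnn N by rewrite /N; solve_mnn.
have N0 y : 0 <= N y by exact: mnn_ge0 mN.
set M := \int[m2]_y N y.
have M0 : 0 <= M by apply: integral_ge0.
have [My|My] := eqVneq M +oo; first by rewrite -/M My poweRyr// leey.
have {}My : M < +oo by rewrite ltey.
pose W x y := F x y `^ r * N y `^ (1 - r).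
have mW : mnn (fun p : X * Y => W p.1 p.2) by rewrite /W; solve_mnn.
(* Z is the part of F that sits over the zeros of N *)
pose Z x y := if N y == 0 then F x y else 0.
have mZ : mnn (fun p : X * Y => Z p.1 p.2).
  apply: (mnn_if (b := fun p : X * Y => N p.2 == 0)) => //.
  apply: (measurable_fun_bool true).
  rewrite (_ : _ @^-1` _ = [set p : X * Y | N p.2 <= 0]).
    have [mN2 _] : mnn (fun p : X * Y => N p.2) by solve_mnn.
    exact: (emeasurable_fun_infty_c measurableT mN2 0).
  by apply/seteqP; split => p /=; rewrite ?eq_le ?N0 ?andbT.
have IZ : \int[m1]_x \int[m2]_y Z x y = 0.
  rewrite tonelli// integral0_eq// => y _; rewrite /Z.
  have [Ny0|_] := eqVneq (N y) 0; last by rewrite integral0.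
  have mFy : mnn (fun x => F x y) by solve_mnn.
  apply: ae_int0 => //.
  have /poweR_eq0_eq0 : N y = 0 by [].
  move=> /(_ (integral_ge0 _ (fun x _ => poweR_ge0 _ _))) I0.
  have : {ae m1, forall x, F x y `^ r = 0} by apply: int0_ae => //; solve_mnn.
  by apply: filterS => x /poweR_eq0_eq0; apply; exact: mnn_ge0 mFy.
have aeZ : {ae m1, forall x, \int[m2]_y Z x y = 0}.
  by apply: int0_ae => //; solve_mnn.
have Nfin : {ae m2, forall y, N y < +oo} by exact: int_lty_ae.
have key : {ae m1, forall x,
    (\int[m2]_y F x y) `^ r <= \int[m2]_y W x y * M `^ (r - 1)}.
  apply: filterS aeZ => x Zx0.
  have mFx : mnn (F x) by solve_mnn.
  have mWx : mnn (W x) by solve_mnn.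
  have mZx : mnn (Z x) by solve_mnn.
  have IW0 : 0 <= \int[m2]_y W x y by apply: integral_ge0 => y _;
    exact: mnn_ge0.
  have : \int[m2]_y F x y <= \int[m2]_y (W x y `^ r^-1 * N y `^ (1 - r^-1)).
    apply: ae_le_int => //; first by solve_mnn.
    apply: filterS2 Nfin (int0_ae mZx Zx0) => y Nyfin.
    rewrite /Z /W; have [Ny0 ->|NyN0 _] := eqVneq (N y) 0.
      by rewrite mule_ge0// poweR_ge0.
    rewrite poweRM ?poweR_ge0// poweRK//; last exact: mnn_ge0 mFx.
    rewrite -muleA -poweRrM -poweRD.
      rewrite (_ : _ + _ = 0)%R; first by rewrite poweRe0 mule1.
      by field.
    rewrite /poweRD_def NyN0 /= ge0_fin_numE// Nyfin/=.
    by rewrite implybT.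
  move=> /le_trans /(_ (hoelder_geometric m2 mWx mN _ _ _)).
  rewrite invr_ge0 (ltW r0) subr_ge0 invf_le1// r1 (addrC r^-1%R) subrK.
  move=> /(_ isT isT erefl).
  move=> /(le_poweR (ltW r0) (integral_ge0 _ (fun y _ => mnn_ge0 y mFx))).
  move=> /le_trans; apply.
  rewrite poweRM ?poweR_ge0// poweRVK// -poweRrM -/M.
  by rewrite (_ : _ * r = r - 1)%R//; field.
apply: (@le_trans _ _ (\int[m1]_x (\int[m2]_y W x y * M `^ (r - 1)))).
  by apply: ae_le_int => //; solve_mnn.
rewrite intZr ?poweR_ge0//; last by solve_mnn.
rewrite -/M (_ : M `^ r = M * M `^ (r - 1)); last first.
  by rewrite -{2}(poweRe1 M0) -poweRD_ge0// addrC subrK.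
apply: lee_wpmul2r; first exact: poweR_ge0.
rewrite tonelli//; apply: le_int => //; first by solve_mnn.
move=> y; rewrite /W intZr ?poweR_ge0//; last by solve_mnn.
have -> : \int[m1]_x F x y `^ r = N y `^ r.
  by rewrite /N poweRVK// integral_ge0// => x _; exact: poweR_ge0.
have [->|Ny0] := eqVneq (N y) 0; first by rewrite poweR0r// mul0e.
have [->|Nyy] := eqVneq (N y) +oo; first exact: leey.
rewrite -poweRD; first by rewrite addrC subrK poweRe1.
by rewrite /poweRD_def Ny0/= ge0_fin_numE// ltey Nyy implybT.
Qed.

End minkowski.

(** * Affine changes of variable and power kernels on the line *)

Section line.
Context {R : realType}.
Notation T := (measurableTypeR R).
Notation leb := (@lebesgue_measure R).

Lemma measurable_affine (c d : R) :
  measurable_fun [set: T] ((fun x : T => (c * x + d)%R) : T -> T).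
Proof. solve_meas. Qed.

Lemma affine_measure (c d : R) (A : set T) : c != 0%R -> measurable A ->
  leb A = `|c|%:E * pushforward leb ((fun x : T => (c * x + d)%R) : T -> T) A.
Proof.
move=> c0 mA; pose phi : T -> T := fun x => (c * x + d)%R.
have mphi : measurable_fun setT phi by exact: measurable_affine.
pose k : {nonneg R} := NngNum (normr_ge0 c).
pose m : {measure set T -> \bar R} := mscale k (pushforward leb phi).
rewrite (@lebesgue_measure_unique R (m mphi)) // => _ [[a b]] _ <-.
rewrite /m /= /mscale /= /pushforward.
have [c_gt0|c_lt0|ceq0] := ltgtP 0%R c; last by rewrite -ceq0 eqxx in c0.
  have -> : phi @^-1` `]a, b]%classic = `]((a - d) / c)%R, ((b - d) /
    c)%R]%classic.
    apply/seteqP; split => x /=;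
      rewrite !in_itv/= /phi ltr_pdivrMr// ler_pdivlMr//;
      by rewrite ltrBlDr lerBrDr mulrC.
  rewrite !lebesgue_measure_itv/= !lte_fin ltr_pM2r ?invr_gt0// ltrD2r.
  case: ifPn => ab; last by rewrite mule0.
  by rewrite -!EFinB -EFinM gtr0_norm//; congr EFin; field; rewrite gt_eqF.
have -> : phi @^-1` `]a, b]%classic = `[((b - d) / c)%R, ((a - d) /
  c)%R[%classic.
  apply/seteqP; split => x /=;
    rewrite !in_itv/= /phi ler_ndivrMr// ltr_ndivlMr//;
    by rewrite ltrBlDr lerBrDr mulrC => /andP[-> ->].
rewrite !lebesgue_measure_itv/= !lte_fin ltr_nM2r ?invr_lt0// ltrD2r.
case: ifPn => ab; last by rewrite mule0.
by rewrite -!EFinB -EFinM ltr0_norm//; congr EFin; field; rewrite lt_eqF.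
Qed.

Lemma int_affine (c d : R) (f : T -> \bar R) : c != 0%R -> mnn f ->
  \int[leb]_x f (c * x + d)%R = `|c|^-1%:E * \int[leb]_x f x.
Proof.
move=> c0 [mf f0]; pose phi : T -> T := fun x => (c * x + d)%R.
have mphi : measurable_fun setT phi by exact: measurable_affine.
pose k : {nonneg R} := NngNum (normr_ge0 c).
pose m : {measure set T -> \bar R} := mscale k (pushforward leb phi).
have -> : \int[leb]_x f x = \int[m mphi]_x f x.
  apply: eq_measure_integral => A mA _.
  exact: (affine_measure d c0 mA).
rewrite ge0_integral_mscale//= ge0_integral_pushforward//= preimage_setT.
by rewrite muleA -EFinM mulVf ?normr_eq0// mul1e.
Qed.

Lemma int_shift (d : R) (f : T -> \bar R) : mnn f ->
  \int[leb]_x f (x + d)%R = \int[leb]_x f x.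
Proof.
move=> mf; have := int_affine d (oner_neq0 R) mf.
rewrite normr1 invr1 mul1e => <-.
by apply: eq_integral => x _; rewrite mul1r.
Qed.

Lemma int_scale (c : R) (f : T -> \bar R) : c != 0%R -> mnn f ->
  \int[leb]_x f (c * x)%R = `|c|^-1%:E * \int[leb]_x f x.
Proof.
move=> c0 mf; rewrite -(int_affine 0 c0 mf).
by apply: eq_integral => x _; rewrite addr0.
Qed.

Lemma int_ball (r : R) : (0 <= r)%R ->
  \int[leb]_x (if `|x|%R <= r then 1 else 0)%R%:E = (2 * r)%:E.
Proof.
move=> r0; have : leb `[(- r)%R, r]%classic = (2 * r)%:E.
  rewrite lebesgue_measure_itv/= lte_fin -EFinB opprK.
  case: ifPn => h; first by congr EFin; ring.
  have -> : r = 0%R by lra.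
  by rewrite mulr0.
move=> <-; rewrite -[X in leb X]setIT -integral_indic//.
apply: eq_integral => x _; rewrite indicE.
congr EFin; rewrite mem_setE in_itv/= -ler_norml.
by case: ifP.
Qed.

(** The hypothesis on [h_ n (c * x)] bounds the integral I of h_ n by 4 B +
    (k/|c|) I; the truncation serves to make I finite, so that I can be
    absorbed. This integrates power functions without antiderivatives: dilating
    by 2 maps such a function to a multiple of itself. *)
Lemma int_dilation_le (h : T -> \bar R) (h_ : nat -> T -> \bar R) (B k c : R) :
  (forall n, mnn (h_ n)) ->
    (forall x, {homo h_ ^~ x : m n / (m <= n)%N >-> m <= n}) ->
  (forall x, \forall n \near \oo, h_ n x = h x) ->
  (forall n x, h_ n x <= (if `|x|%R <= n.+1%:R then n.+1%:R else 0)%R%:E) ->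
  (0 <= B)%R -> (0 <= k)%R -> c != 0%R -> (k / `|c| < 1)%R ->
  (forall n x, h_ n x <=
     (B * (if `|x|%R <= 2 then 1 else 0)%R)%:E + k%:E * h_ n (c * x)%R) ->
  \int[leb]_x h x <= (B * 4 / (1 - k / `|c|))%:E.
Proof.
move=> mh ndh cvgh bh B0 k0 c0 kc rec.
have mball (r s : R) : (0 <= s)%R ->
    mnn (fun x : T => (if `|x|%R <= r then s else 0)%R%:E).
  move=> s0; apply: mnn_EFin; last by move=> x; case: ifP.
  by apply: measurable_fun_ifT => //; solve_meas.
have bnd n : \int[leb]_x h_ n x <= (B * 4 / (1 - k / `|c|))%:E.
  have fin : \int[leb]_x h_ n x < +oo.
    have := le_int leb (mh n) (mball n.+1%:R n.+1%:R (ler0n _ _)) (bh n).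
    move=> /le_lt_trans; apply.
    rewrite (_ : \int[leb]_x _ = \int[leb]_x (n.+1%:R%:E * (if `|x|%R <=
      n.+1%:R then 1 else 0)%R%:E)).
      rewrite intZl ?lee_fin//; last exact: mball.
      by rewrite int_ball// -EFinM ltry.
    by apply: eq_integral => x _; case: ifP; rewrite -EFinM ?mulr1 ?mulr0.
  have mhc : mnn (fun x : T => h_ n (c * x)%R) by have := mh n => H; solve_mnn.
  have mB : mnn (fun x : T => (B * (if `|x|%R <= 2 then 1 else 0)%R)%:E).
    have : mnn (fun x : T => B%:E * (if `|x|%R <= 2 then 1 else 0)%R%:E).
      apply: mnnM; last exact: mball.
      by apply: mnn_cst; rewrite lee_fin.
    by under eq_fun do rewrite -EFinM.
  have mk : mnn (fun x : T => k%:E * h_ n (c * x)%R).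
    by apply: mnnM => //; apply: mnn_cst; rewrite lee_fin.
  have IB : \int[leb]_x (B * (if `|x|%R <= 2 then 1 else 0)%R)%:E = (B * 4)%:E.
    under eq_integral do rewrite EFinM.
    rewrite intZl ?lee_fin//; last exact: mball.
    by rewrite int_ball// -EFinM; congr EFin; ring.
  have := le_int leb (mh n) (mnnD mB mk) (rec n).
  rewrite (intD _ mB mk) intZl ?lee_fin// int_scale//.
  rewrite IB.
  have : 0 <= \int[leb]_x h_ n x by apply: integral_ge0 => x _; exact: mnn_ge0.
  move: fin; case: (\int[leb]_x h_ n x) => // J _.
  rewrite -!EFinM -EFinD !lee_fin => J0.
  set th := (k / `|c|)%R in kc *.
  rewrite (_ : (k * (_ * J) = th * J)%R); last by rewrite /th mulrA.
  move=> hh; rewrite ler_pdivlMr ?subr_gt0//; lra.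
have -> : \int[leb]_x h x = limn (fun n => \int[leb]_x h_ n x).
  rewrite -monotone_convergence => [|//|n|n x _|x _ m n mn].
  - apply: eq_integral => x _; apply/esym/cvg_lim => //.
    by apply: cvg_near_cst; exact: cvgh.
  - by have [] := mh n.
  - exact: mnn_ge0.
  - exact: ndh.
apply: lime_le; last by apply: nearW.
apply: ereal_nondecreasing_is_cvgn => m n mn.
by apply: le_int => // x; exact: ndh.
Qed.

Definition near_kernel (g d : R) (u : T) : \bar R :=
  if (`|u| <= d)%R then (`|u| `^ (- g))%:E else 0.
Definition far_kernel (g d : R) (u : T) : \bar R :=
  if (d < `|u|)%R then (`|u| `^ (- g))%:E else 0.

Lemma mnn_near g d : mnn (near_kernel g d).
Proof. by rewrite /near_kernel; solve_mnn. Qed.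

Lemma mnn_far g d : mnn (far_kernel g d).
Proof. by rewrite /far_kernel; solve_mnn. Qed.

Lemma int_near_kernel (g : R) : (0 <= g)%R -> (g < 1)%R ->
  exists2 c : R, (0 < c)%R & forall d : R, (0 < d)%R ->
    \int[leb]_u near_kernel g d u <= (c * d `^ (1 - g))%:E.
Proof.
move=> g0 g1.
have k0 : (0 <= (2 `^ g : R))%R by exact: powR_ge0.
have k1 : ((2 `^ g : R) / `|2| < 1)%R.
  rewrite ger0_norm// ltr_pdivrMr// mul1r.
  rewrite -[X in (_ < X)%R](@powRr1 R 2)// /powR (negbTE (lt0r_neq0 _))//.
  by rewrite ltr_expR ltr_pM2r// ln_gt0// ltr1n.
pose c := ((2 `^ g : R) * 4 / (1 - 2 `^ g / `|2|))%R.
exists c.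
  by rewrite /c divr_gt0// ?subr_gt0// mulr_gt0// powR_gt0.
have I1 : \int[leb]_u near_kernel g 1 u <= c%:E.
  pose h_ n (u : T) : \bar R :=
    if (`|u| <= 1)%R then (Num.min (`|u| `^ (- g)) n.+1%:R)%:E else 0.
  apply: (@int_dilation_le (near_kernel g 1) h_ (2 `^ g)%R (2 `^ g)%R 2%R) =>
    //.
  - move=> n; rewrite /h_; apply: mnn_if; [by solve_meas| |exact: mnn_cst].
    apply: mnn_EFin; last by move=> x; rewrite le_min powR_ge0/=.
    apply: measurable_minr => //.
    by apply: (measurableT_comp (measurable_powR _)); solve_meas.
  - move=> x m n mn; rewrite /h_; case: ifP => // _.
    by rewrite lee_fin le_min ge_min lexx/= ge_min ler_nat ltnS mn orbT.
  - move=> x; rewrite /h_ /near_kernel; case: ifP => _; last by apply: nearW.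
    near=> n; congr EFin; apply/min_idPl; near: n.
    exists (Num.truncn (`|x| `^ (- g))) => // n /= hn.
    have := truncnS_gt (`|x| `^ (- g))%R => /ltW/le_trans; apply.
    by rewrite ler_nat.
  - move=> n x; rewrite /h_; case: ifPn => [x1|_]; last first.
      by rewrite lee_fin; case: ifP.
    by rewrite (le_trans x1) ?ler1n// lee_fin ge_min lexx orbT.
  - have h0 n y : 0 <= h_ n y.
      by rewrite /h_; case: ifP => // _; rewrite lee_fin le_min powR_ge0/=.
    move=> n x; rewrite {1}/h_; case: ifPn => [x1|_]; last first.
      apply: adde_ge0; last by apply: mule_ge0; rewrite ?lee_fin.
      by rewrite lee_fin mulr_ge0//; case: ifP.
    rewrite /h_ (le_trans x1) ?ler1n// mulr1.
    have [x2|x2] := leP (`|2 * x|)%R 1%R.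
      rewrite -[leLHS]add0e; apply: leeD; first by rewrite lee_fin.
      rewrite -EFinM lee_fin normrM powRM// ger0_norm//.
      have K1 : (1 <= (2 `^ g : R))%R.
        by rewrite -[leLHS](powRr0 (2:R)) ler_powR ?ler1n.
      rewrite minr_pMr// mulrA (powRN 2) divff ?mul1r; last first.
        by rewrite gt_eqF// powR_gt0.
      by rewrite le_min !ge_min lexx/= ler_peMl ?orbT.
    rewrite mule0 adde0 lee_fin ge_min; apply/orP; left.
    rewrite powRN -[leRHS]invrK lef_pV2 ?posrE ?invr_gt0 ?powR_gt0//;
      last first.
      by move: x2; rewrite normrM ger0_norm//; lra.
    rewrite -powRN -[(- g)%R]mulN1r powRrM powR_inv1//.
    apply: ge0_ler_powR => //; rewrite ?nnegrE ?invr_ge0//.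
    by move: x2; rewrite normrM ger0_norm//; lra.
move=> d d0.
have := int_scale (c := d^-1) (f := near_kernel g 1).
rewrite invr_eq0 gt_eqF// => /(_ isT (mnn_near _ _)).
rewrite gtr0_norm ?invr_gt0// invrK => E.
have -> : \int[leb]_u near_kernel g d u =
    \int[leb]_u ((d `^ (- g))%:E * near_kernel g 1 (d^-1 * u)%R).
  apply: eq_integral => u _; rewrite /near_kernel normrM gtr0_norm ?invr_gt0//.
  rewrite mulrC ler_pdivrMr// mul1r; case: ifP => _; last by rewrite mule0.
  by rewrite -EFinM -powRM ?divr_ge0 ?(ltW d0)//; congr ((_ `^ _)%R%:E);
    field; rewrite gt_eqF.
rewrite intZl ?lee_fin ?powR_ge0//; last first.
  by have := mnn_near g 1 => H; solve_mnn.
rewrite E muleA -EFinM.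
have -> : (d `^ (- g) * d = d `^ (1 - g))%R.
  rewrite -{2}(powRr1 (ltW d0)) -powRD; first by rewrite addrC.
  by rewrite (gt_eqF d0) implybT.
by rewrite mulrC EFinM; apply: lee_wpmul2l => //; rewrite lee_fin powR_ge0.
Unshelve. all: by end_near. Qed.

Lemma int_far_kernel :
  exists2 c : R, (0 < c)%R & forall d : R, (0 < d)%R ->
    \int[leb]_u far_kernel 2 d u <= (c / d)%:E.
Proof.
pose c := (1 * 4 / (1 - 4^-1 / `|2^-1|) : R)%R.
exists c.
  by rewrite /c ger0_norm ?invr_ge0// invrK divr_gt0//; lra.
have I1 : \int[leb]_u far_kernel 2 1 u <= c%:E.
  pose h_ n (u : T) : \bar R :=
    if (`|u| <= n.+1%:R)%R then far_kernel 2 1 u else 0.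
  have powN2 (x : R) : (0 <= x)%R -> (x `^ (- 2) = x ^- 2)%R.
    by move=> x0; rewrite powR_invn.
  apply: (@int_dilation_le (far_kernel 2 1) h_ 1%R 4^-1%R 2^-1%R) => //.
  - move=> n; rewrite /h_; have := mnn_far 2 1 => H; solve_mnn.
  - move=> x m n mn; rewrite /h_; case: ifPn => // xm.
      by rewrite (le_trans xm)// ler_nat ltnS.
    by case: ifP => // _; exact: mnn_ge0 (mnn_far 2 1).
  - move=> x; rewrite /h_; exists (Num.truncn `|x|) => // n /= hn.
    rewrite (_ : (`|x| <= n.+1%:R)%R)//.
    have := truncnS_gt `|x|%R => /ltW/le_trans; apply.
    by rewrite ler_nat.
  - move=> n x; rewrite /h_; case: ifPn => // _.
    rewrite /far_kernel; case: ifPn => [x1|_]; last by rewrite lee_fin.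
    rewrite lee_fin powN2// (@le_trans _ _ 1%R) ?ler1n//.
    by rewrite invf_le1 ?exprn_ege1 ?exprn_gt0 ?(lt_trans ltr01)// ltW.
  - by rewrite ger0_norm ?invr_ge0// invrK; lra.
  - move=> n x; rewrite /h_ mul1r.
    have R0 : 0 <= 4^-1%:E * (if (`|2^-1 * x| <= n.+1%:R)%R
        then far_kernel 2 1 (2^-1 * x)%R else 0).
      rewrite mule_ge0 ?lee_fin ?invr_ge0//; case: ifP => // _.
      exact: mnn_ge0 (mnn_far 2 1).
    case: ifPn => [xn|_]; last first.
      by rewrite adde_ge0// lee_fin; case: ifP.
    have [x2|x2] := leP `|x|%R 2%R.
      rewrite -[leLHS]adde0; apply: leeD => //; rewrite /far_kernel;
        case: ifPn => [x1|_]; last by rewrite lee_fin.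
      rewrite lee_fin powN2//.
      by rewrite invf_le1 ?exprn_ege1 ?exprn_gt0 ?(lt_trans ltr01)// ltW.
    rewrite add0e normrM ger0_norm ?invr_ge0// (_ : (2^-1 * `|x| <=
      n.+1%:R)%R); last first.
      by apply: le_trans xn; lra.
    rewrite /far_kernel (_ : (1 < `|x|)%R) ?(lt_trans _ x2) ?ltr1n//.
    rewrite normrM (ger0_norm (x := 2^-1)) ?invr_ge0//.
    rewrite (_ : (1 < 2^-1 * `|x|)%R); last by lra.
    rewrite -EFinM lee_fin !powN2 ?mulr_ge0 ?invr_ge0//.
    rewrite le_eqVlt; apply/orP; left; apply/eqP; field.
    by rewrite gt_eqF// (lt_trans _ x2).
move=> d d0.
have := int_scale (c := d^-1) (f := far_kernel 2 1).
rewrite invr_eq0 gt_eqF// => /(_ isT (mnn_far _ _)).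
rewrite gtr0_norm ?invr_gt0// invrK => E.
have -> : \int[leb]_u far_kernel 2 d u =
    \int[leb]_u ((d `^ (- 2))%:E * far_kernel 2 1 (d^-1 * u)%R).
  apply: eq_integral => u _; rewrite /far_kernel normrM gtr0_norm ?invr_gt0//.
  rewrite [(_ * `|u|)%R]mulrC ltr_pdivlMr// mul1r; case: ifP => _;
    last by rewrite mule0.
  by rewrite -EFinM -powRM ?divr_ge0 ?(ltW d0)//; congr ((_ `^ _)%R%:E);
    field; rewrite gt_eqF.
rewrite intZl ?lee_fin ?powR_ge0//; last first.
  by have := mnn_far 2 1 => H; solve_mnn.
rewrite E muleA -EFinM.
have -> : (d `^ (- 2) * d = d^-1)%R.
  rewrite powR_invn ?ltW//; field; exact: lt0r_neq0.
by rewrite mulrC EFinM; apply: lee_wpmul2l => //; rewrite lee_fin invr_ge0 ltW.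
Qed.

End line.

(** * The Hardy-Littlewood-Sobolev inequality *)

Section hls.
Context {R : realType}.
Notation T := (measurableTypeR R).
Notation leb := (@lebesgue_measure R).

Lemma expR_powR (x r : R) : (expR x `^ r = expR (r * x))%R.
Proof. by rewrite /powR gt_eqF ?expR_gt0// expRK. Qed.

(** The radius d balances the two terms of [hls_inner]: both are then constant
    multiples of n^(1 - 2/q) a^p. *)
Lemma hls_balance (q a n c1 c2 : R) : (2 < q)%R -> (0 < a)%R -> (0 < n)%R ->
  (0 < c1)%R -> (0 < c2)%R ->
  let p := (q / (q - 1))%R in let d := (n / a `^ p)%R in
  (a * (a * (c1 * d `^ (1 - 2 / q)) + n `^ p^-1 * (c2 / d) `^ q^-1) =
   (c1 + c2 `^ q^-1) * (n `^ (1 - 2 / q) * a `^ p))%R.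
Proof.
move=> q2 a0 n0 c10 c20 p d.
have q0 : q != 0%R by rewrite gt_eqF//; lra.
have q1 : (q - 1)%R != 0%R by rewrite gt_eqF//; lra.
pose L := ln n; pose B := ln a; pose D := ln c2.
have -> : a = expR B by rewrite lnK.
have -> : n = expR L by rewrite lnK.
have -> : d = expR (L - p * B).
  by rewrite /d expRB -(expR_powR B p) /L /B !lnK.
have -> : c2 = expR D by rewrite lnK.
rewrite -expRB !expR_powR.
rewrite !mulrDr !mulrDl; congr (_ + _)%R.
  rewrite [(expR B * (c1 * _))%R]mulrCA [LHS]mulrCA; congr (_ * _)%R.
  by rewrite -!expRD; congr expR; rewrite /p; field; rewrite q0 q1.
by rewrite -!expRD; congr expR; rewrite /p; field; rewrite q0 q1.
Qed.

Section inner.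
Variables (q : R) (G : T -> \bar R) (c1 c2 : R).
Hypotheses (q2 : (2 < q)%R) (mG : mnn G) (c10 : (0 < c1)%R) (c20 : (0 < c2)%R).
Hypothesis near_le : forall d : R, (0 < d)%R ->
  \int[leb]_u near_kernel (2 / q) d u <= (c1 * d `^ (1 - 2 / q))%:E.
Hypothesis far_le : forall d : R, (0 < d)%R ->
  \int[leb]_u far_kernel 2 d u <= (c2 / d)%:E.
Let p := (q / (q - 1))%R.
Variable n : R.
Hypothesis n0 : (0 < n)%R.
Hypothesis nE : \int[leb]_v G v `^ p = n%:E.

(** Only the w with G(w) <= G(v) = a are considered. Within distance d of v,
    bound G(w) by a and integrate the kernel; beyond d, use Hoelder's
    inequality and the L^p norm of G, the kernel to the power q being |w-v|^-2. *)
Lemma hls_inner (v : T) :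
  G v * (\int[leb]_w (if G w <= G v then
    G w * (`|w - v| `^ (- (2 / q)))%:E else 0)) <=
  (c1 + c2 `^ q^-1)%:E * ((n `^ (1 - 2 / q))%:E * G v `^ p).
Proof.
have q0 : (0 < q)%R by exact: lt_trans q2.
have q1 : (0 < q - 1)%R by rewrite subr_gt0 (lt_trans _ q2)// ltr1n.
have p0 : (0 < p)%R by rewrite divr_gt0.
have C0 : (0 < c1 + c2 `^ q^-1)%R by rewrite addr_gt0// powR_gt0.
have N0 : (0 < n `^ (1 - 2 / q))%R by rewrite powR_gt0.
have mK : mnn (fun w => if G w <= G v then
    G w * (`|w - v| `^ (- (2 / q)))%:E else 0).
  apply: (mnn_if (b := fun w => G w <= G v)); [|by solve_mnn|exact: mnn_cst].
  apply: (measurable_fun_bool true).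
  have [mG1 _] := mG.
  have := emeasurable_fun_infty_c measurableT mG1 (G v).
  by rewrite setTI.
have Gv0 := mnn_ge0 v mG.
have [->|Gvy] := eqVneq (G v) +oo.
  by rewrite poweRyr ?gt_eqF// gt0_muley ?lte_fin// gt0_muley ?lte_fin// leey.
have [->|GvN0] := eqVneq (G v) 0.
  by rewrite mul0e poweR0r ?gt_eqF// !mule0.
case E : (G v) Gv0 Gvy GvN0 => [a| |]//; rewrite lee_fin eqe => a0 _ aN0.
have {aN0}a0 : (0 < a)%R by rewrite lt0r aN0.
pose d := (n / a `^ p)%R.
have d0 : (0 < d)%R by rewrite divr_gt0// powR_gt0.
have m1 : mnn (fun w : T => a%:E * near_kernel (2 / q) d (w - v)%R).
  apply: mnnM; first by apply: mnn_cst; rewrite lee_fin ltW.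
  by apply: (mnn_comp1 (mnn_near _ _)); solve_meas.
have mf (g : R) : mnn (fun w : T => far_kernel g d (w - v)%R).
  by apply: (mnn_comp1 (mnn_far _ _)); solve_meas.
have m2 : mnn (fun w => G w * far_kernel (2 / q) d (w - v)%R) by exact: mnnM.
have I1 : \int[leb]_w (a%:E * near_kernel (2 / q) d (w - v)%R) <=
    (a * (c1 * d `^ (1 - 2 / q)))%:E.
  rewrite intZl ?lee_fin ?(ltW a0)//; last first.
    by apply: (mnn_comp1 (mnn_near _ _)); solve_meas.
  rewrite EFinM; apply: lee_wpmul2l; first by rewrite lee_fin ltW.
  by rewrite (int_shift (- v) (mnn_near (2 / q) d)); exact: near_le.
have I2 : \int[leb]_w (G w * far_kernel (2 / q) d (w - v)%R) <=
    (n `^ p^-1 * (c2 / d) `^ q^-1)%:E.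
  have -> : \int[leb]_w (G w * far_kernel (2 / q) d (w - v)%R) =
      \int[leb]_w ((G w `^ p) `^ p^-1 * (far_kernel 2 d (w - v)%R) `^ q^-1).
    apply: eq_integral => w _; rewrite poweRK ?gt_eqF//; last exact: mnn_ge0.
    congr (_ * _); rewrite /far_kernel; case: ifPn => _.
      by rewrite poweR_EFin -powRrM; congr (_ `^ _)%R%:E; rewrite mulNr.
    by rewrite poweR0r// invr_eq0 gt_eqF.
  apply: (le_trans (@hoelder_geometric R _ T leb _ _ p^-1%R q^-1%R (mnnX p mG)
    (mf 2%R) _ _ _)).
  - by rewrite invr_ge0 ltW.
  - by rewrite invr_ge0 ltW.
  - by rewrite /p; field; rewrite (gt_eqF q0)/= (gt_eqF q1).
  rewrite nE poweR_EFin EFinM.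
  apply: lee_wpmul2l; first by rewrite lee_fin powR_ge0.
  rewrite -poweR_EFin; apply: le_poweR; first by rewrite invr_ge0 ltW.
    by apply: integral_ge0 => w _; exact: mnn_ge0 (mf _).
  by rewrite (int_shift (- v) (mnn_far 2 d)); exact: far_le.
have : \int[leb]_w (if G w <= a%:E then
    G w * (`|w - v| `^ (- (2 / q)))%:E else 0) <=
  (a * (c1 * d `^ (1 - 2 / q)))%:E + (n `^ p^-1 * (c2 / d) `^ q^-1)%:E.
  apply: le_trans (leeD I1 I2).
  have m10 w := mnn_ge0 w m1; have m20 w := mnn_ge0 w m2.
  rewrite -(intD _ m1 m2); apply: le_int; rewrite ?E//; first by rewrite -E.
    exact: mnnD.
  move=> w; case: ifPn => [Gwa|_]; last by rewrite adde_ge0.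
  rewrite /near_kernel /far_kernel; case: ifPn => wd.
    rewrite ltNge wd/= mule0 adde0.
    by apply: lee_wpmul2r => //; rewrite lee_fin powR_ge0.
  rewrite -ltNge in wd; rewrite wd mule0 add0e//.
rewrite -EFinD => h.
apply: (le_trans (lee_wpmul2l _ h)); first by rewrite lee_fin ltW.
by rewrite poweR_EFin -!EFinM lee_fin hls_balance.
Qed.

End inner.

(** The kernel is symmetric and both functions are the same, so that one may
    restrict to G(w) <= G(v), where [hls_inner] applies; the integral over v of
    its right-hand side is again a power of the L^p norm of G. *)
Lemma hardy_littlewood_sobolev (q : R) : (2 < q)%R -> exists2 C : R, (0 < C)%R &
  forall G : T -> \bar R, mnn G ->
  \int[leb]_v \int[leb]_w (G v * G w * (`|w - v| `^ (- (2 / q)))%:E) <=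
  C%:E * (\int[leb]_v G v `^ (q / (q - 1))) `^ (2 * (q - 1) / q).
Proof.
move=> q2.
have q0 : (0 < q)%R by lra.
have g0 : (0 <= 2 / q)%R by rewrite divr_ge0// ltW.
have g1 : (2 / q < 1)%R by rewrite ltr_pdivrMr// mul1r.
have [c1 c10 near_le] := int_near_kernel g0 g1.
have [c2 c20 far_le] := @int_far_kernel R.
pose C0 := (c1 + c2 `^ q^-1)%R.
have C00 : (0 < C0)%R by rewrite addr_gt0// powR_gt0.
exists (2 * C0)%R; first by rewrite mulr_gt0.
move=> G mG; pose p := (q / (q - 1))%R.
have p0 : (0 < p)%R by rewrite divr_gt0//; lra.
have r0 : (0 < 2 * (q - 1) / q)%R by rewrite divr_gt0// mulr_gt0//; lra.
have mK : mnn (fun z : T * T => G z.1 * G z.2 * (`|z.2 - z.1| `^ (- (2 /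
  q)))%:E).
  by solve_mnn.
have mGp : mnn (fun v => G v `^ p) by solve_mnn.
have : 0 <= \int[leb]_v G v `^ p by apply: integral_ge0 => v _;
  exact: poweR_ge0.
case E : (\int[leb]_v G v `^ p) => [n| |]// n0; last first.
  by rewrite poweRyr ?gt_eqF// gt0_muley ?leey// lte_fin mulr_gt0.
have [n00|nN0] := eqVneq n 0%R.
  rewrite n00 in E.
  have Gae : {ae leb, forall v, G v = 0}.
    apply: filterS (int0_ae mGp E) => v /poweR_eq0_eq0; apply.
    exact: mnn_ge0.
  rewrite ae_int0; first by rewrite n00 poweR0r ?gt_eqF// mule0.
    by solve_mnn.
  apply: filterS Gae => v Gv0; rewrite integral0_eq// => w _.
  by rewrite Gv0 !mul0e.
have {n0 nN0}n0 : (0 < n)%R by rewrite lt0r nN0.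
have inner v := @hls_inner q G c1 c2 q2 mG c10 c20 near_le far_le n n0 E v.
pose H v w := if G w <= G v then
  G v * G w * (`|w - v| `^ (- (2 / q)))%:E else 0.
have H0 v w : 0 <= H v w.
  rewrite /H; case: ifP => // _; rewrite !mule_ge0 ?lee_fin ?powR_ge0//;
    exact: mnn_ge0.
have mH : mnn (fun z : T * T => H z.1 z.2).
  apply: (mnn_if (b := fun z : T * T => G z.2 <= G z.1)) => //.
  apply: measurable_fun_lee.
    by have [] : mnn (fun z : T * T => G z.2) by solve_mnn.
  by have [] : mnn (fun z : T * T => G z.1) by solve_mnn.
have IH : \int[leb]_v \int[leb]_w H v w <= C0%:E * (n `^ (1 - 2 / q) * n)%:E.
  apply: (@le_trans _ _ (\int[leb]_v (C0%:E * ((n `^ (1 - 2 / q))%:E * G v `^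
    p)))).
    apply: le_int; first by solve_mnn.
      apply: mnnM; first by apply: mnn_cst; rewrite lee_fin ltW.
      by apply: mnnM => //; apply: mnn_cst; rewrite lee_fin powR_ge0.
    move=> v; apply: le_trans (inner v).
    have mI : mnn (fun w => if G w <= G v then
        G w * (`|w - v| `^ (- (2 / q)))%:E else 0).
      apply: (mnn_if (b := fun w => G w <= G v)) => //; last by solve_mnn.
      apply: measurable_fun_lee => //.
      by have [] := mG.
    rewrite -intZl//; last exact: mnn_ge0.
    apply: le_int; first by solve_mnn.
      by apply: mnnM => //; apply: mnn_cst; exact: mnn_ge0.
    by move=> w; rewrite /H; case: ifP => _; rewrite ?mule0// muleA.
  rewrite !intZl ?lee_fin ?powR_ge0 ?(ltW C00)//.
    by rewrite E EFinM.
  by apply: mnnM => //; apply: mnn_cst; rewrite lee_fin powR_ge0.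
have -> : (2 * C0)%:E * n%:E `^ (2 * (q - 1) / q) =
    C0%:E * (n `^ (1 - 2 / q) * n)%:E + C0%:E * (n `^ (1 - 2 / q) * n)%:E.
  rewrite poweR_EFin -!EFinM -EFinD; congr EFin.
  have -> : (n `^ (1 - 2 / q) * n = n `^ (2 * (q - 1) / q))%R.
    rewrite -{2}(powRr1 (ltW n0)) -powRD; last by rewrite (gt_eqF n0) implybT.
    by congr (_ `^ _)%R; field; rewrite gt_eqF.
  by ring.
apply: le_trans (leeD IH IH).
rewrite [X in _ <= _ + X]tonelli//.
have m1 : mnn (fun v => \int[leb]_w H v w) by solve_mnn.
have m2 : mnn (fun w => \int[leb]_v H v w).
  by apply: (@mnn_int _ _ _ _ _ leb (fun w v => H v w)); solve_mnn.
rewrite -(intD _ m1 m2).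
apply: le_int; [by solve_mnn|exact: (mnnD m1 m2)|move=> v].
have m3 : mnn (fun w => H v w) by solve_mnn.
have m4 : mnn (fun w => H w v) by solve_mnn.
rewrite -(intD _ m3 m4).
apply: le_int; [by solve_mnn|exact: (mnnD m3 m4)|move=> w].
have K0 u z : 0 <= G u * G z * (`|z - u| `^ (- (2 / q)))%:E.
  by rewrite !mule_ge0 ?lee_fin ?powR_ge0//; exact: mnn_ge0.
have [wv|vw] := leP (G w) (G v).
  by rewrite {1}/H wv leeDl.
rewrite [X in _ <= _ + X]/H (ltW vw).
by rewrite (muleC (G w)) (distrC v w) leeDr.
Qed.

End hls.

(** * The Radon transform in one variable *)

Section minkowski2.
Context {R : realType} d1 d2 d3 (X : measurableType d1) (V : measurableType d2)
  (W : measurableType d3).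
Variable m1 : {sigma_finite_measure set X -> \bar R}.
Variable m2 : {sigma_finite_measure set V -> \bar R}.
Variable m3 : {sigma_finite_measure set W -> \bar R}.

Lemma minkowski_integral2 (F : X -> V -> W -> \bar R) (r : R) :
  mnn (fun p : X * V * W => F p.1.1 p.1.2 p.2) -> (1 <= r)%R ->
  \int[m1]_x (\int[m2]_v \int[m3]_w F x v w) `^ r <=
  (\int[m2]_v \int[m3]_w (\int[m1]_x F x v w `^ r) `^ r^-1) `^ r.
Proof.
move=> mF r1; have r0 : (0 < r)%R by exact: lt_le_trans r1.
apply: (le_trans (minkowski_integral m1 m2 (F :=
  fun x v => \int[m3]_w F x v w) _ r1)).
  by solve_mnn.
apply: le_poweR; first exact: ltW.
  by apply: integral_ge0 => v _; exact: poweR_ge0.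
have m4 : mnn (fun v => (\int[m1]_x (\int[m3]_w F x v w) `^ r) `^ r^-1) by
  solve_mnn.
have m5 : mnn (fun v => \int[m3]_w (\int[m1]_x F x v w `^ r) `^ r^-1) by
  solve_mnn.
apply: le_int => // v.
rewrite -[leRHS](poweRK (lt0r_neq0 r0)); last exact: mnn_ge0 m5.
apply: le_poweR; first by rewrite invr_ge0 ltW.
  by apply: integral_ge0 => x _; exact: poweR_ge0.
apply: (minkowski_integral m1 m3 (F := fun x w => F x v w)) => //.
by solve_mnn.
Qed.

End minkowski2.

Section radon1_direct.
Context {R : realType}.
Notation T := (measurableTypeR R).
Notation leb := (@lebesgue_measure R).

(** Young's inequality ||phi * psi||_k <= ||phi||_s ||psi||_s, 2/s = 1 + 1/k,
    for the powers 1/s of phi and psi. Split the integrand as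
      (phi psi)^(1/k) ((phi psi)^(1/2))^(1 - 1/k)
    and apply Hoelder's inequality: only the first factor depends on the lag r
    in the end, and its integral over r is the product of the integrals. *)
Lemma young_correlation (phi psi : T -> \bar R) (k : R) : (1 <= k)%R ->
  mnn phi -> mnn psi ->
  \int[leb]_r (\int[leb]_t (phi t `^ ((k + 1) / (2 * k)) *
     psi (t + r)%R `^ ((k + 1) / (2 * k)))) `^ k <=
  (\int[leb]_t phi t) `^ ((k + 1) / 2) * (\int[leb]_t psi t) `^ ((k + 1) / 2).
Proof.
move=> k1 mphi mpsi.
have k0 : (0 < k)%R by exact: lt_le_trans k1.
have kN0 : k != 0%R by rewrite gt_eqF.
have kV1 : (k^-1 <= 1)%R by rewrite invf_le1.
set A := \int[leb]_t phi t; set B := \int[leb]_t psi t.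
have A0 : 0 <= A by apply: integral_ge0 => t _; exact: mnn_ge0.
have B0 : 0 <= B by apply: integral_ge0 => t _; exact: mnn_ge0.
pose D := (A `^ 2^-1 * B `^ 2^-1) `^ (k - 1).
have key r : (\int[leb]_t (phi t `^ ((k + 1) / (2 * k)) *
     psi (t + r)%R `^ ((k + 1) / (2 * k)))) `^ k <=
   (\int[leb]_t (phi t * psi (t + r)%R)) * D.
  have mpr : mnn (fun t : T => psi (t + r)%R) by solve_mnn.
  have m1 : mnn (fun t : T => phi t * psi (t + r)%R) by exact: mnnM.
  have m2 : mnn (fun t : T => phi t `^ 2^-1 * psi (t + r)%R `^ 2^-1) by
    solve_mnn.
  have -> : \int[leb]_t (phi t `^ ((k + 1) / (2 * k)) *
      psi (t + r)%R `^ ((k + 1) / (2 * k))) =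
    \int[leb]_t ((phi t * psi (t + r)%R) `^ k^-1 *
      (phi t `^ 2^-1 * psi (t + r)%R `^ 2^-1) `^ (1 - k^-1)).
    apply: eq_integral => t _.
    have p0 := mnn_ge0 t mphi; have s0 := mnn_ge0 t mpr.
    rewrite !poweRM ?poweR_ge0// -!poweRrM.
    have -> : ((k + 1) / (2 * k) = k^-1 + 2^-1 * (1 - k^-1))%R by field.
    rewrite !poweRD_ge0 ?invr_ge0 ?(ltW k0) ?mulr_ge0 ?subr_ge0 ?invr_ge0//.
    by rewrite muleACA.
  have h1 := @hoelder_geometric R _ T leb _ _ k^-1%R (1 - k^-1)%R m1 m2.
  have h2 := @hoelder_geometric R _ T leb _ _ 2^-1%R 2^-1%R mphi mpr.
  rewrite (int_shift r mpsi) -/A -/B in h2.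
  have {h2}h2 := h2 (ltac:(by rewrite invr_ge0)) (ltac:(by rewrite invr_ge0))
    (ltac:(by field)).
  have {h1}h1 := h1 (ltac:(by rewrite invr_ge0 ltW)) (ltac:(by rewrite
    subr_ge0))
    (ltac:(by rewrite addrC subrK)).
  have I1 : 0 <= \int[leb]_t (phi t * psi (t + r)%R).
    by apply: integral_ge0 => t _; exact: mnn_ge0 m1.
  have I2 : 0 <= \int[leb]_t (phi t `^ 2^-1 * psi (t + r)%R `^ 2^-1).
    by apply: integral_ge0 => t _; exact: mnn_ge0 m2.
  apply: (le_trans (le_poweR (ltW k0) _ h1)).
    by apply: integral_ge0 => t _; rewrite mule_ge0 ?poweR_ge0.
  rewrite poweRM ?poweR_ge0// poweRVK// -poweRrM.
  rewrite (_ : (1 - k^-1) * k = k - 1)%R; last by field.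
  apply: lee_wpmul2l => //; apply: le_poweR => //.
  by rewrite subr_ge0.
have mF : mnn (fun z : T * T => phi z.2 * psi (z.2 + z.1)%R) by solve_mnn.
have mL : mnn (fun r : T => (\int[leb]_t (phi t `^ ((k + 1) / (2 * k)) *
     psi (t + r)%R `^ ((k + 1) / (2 * k)))) `^ k) by solve_mnn.
have mM : mnn (fun r : T => \int[leb]_t (phi t * psi (t + r)%R)) by solve_mnn.
apply: (@le_trans _ _ (\int[leb]_r ((\int[leb]_t (phi t * psi (t + r)%R)) *
  D))).
  apply: le_int => //; apply: mnnM => //; apply: mnn_cst; exact: poweR_ge0.
rewrite intZr ?poweR_ge0// (tonelli leb leb (f :=
  fun r t => phi t * psi (t + r)%R))//.
have -> : \int[leb]_t \int[leb]_r (phi t * psi (t + r)%R) = A * B.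
  rewrite -intZr//; apply: eq_integral => t _.
  rewrite intZl; [|by solve_mnn|exact: mnn_ge0].
  congr (_ * _); rewrite /B -(int_shift t mpsi).
  by apply: eq_integral => r _; rewrite addrC.
rewrite /D poweRM ?poweR_ge0// -!poweRrM muleACA.
have -> : ((k + 1) / 2 = 1 + 2^-1 * (k - 1))%R by field.
by rewrite !poweRD_ge0 ?mulr_ge0 ?subr_ge0// !poweRe1.
Qed.

Definition radon1 (g : T -> T -> \bar R) (x t : T) : \bar R :=
  \int[leb]_v g v (t + x * v)%R.

Lemma mnn_radon1 (g : T -> T -> \bar R) : mnn (fun p : T * T => g p.1 p.2) ->
  mnn (fun p : T * T => radon1 g p.1 p.2).
Proof. by move=> mg; rewrite /radon1; solve_mnn. Qed.

(** Boundedness from L^p_v L^(q/(k+1))_t to L^q_x L^(q/k)_t, p = q / (q - 1),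
    raised to the power q so that every exponent outside an integral is
    explicit. *)
Definition radon1_bound (q k : R) := exists2 C : R, (0 < C)%R &
  forall g : T -> T -> \bar R, mnn (fun p : T * T => g p.1 p.2) ->
  \int[leb]_x (\int[leb]_t radon1 g x t `^ (q / k)) `^ k <=
  C%:E * (\int[leb]_v (\int[leb]_t g v t `^ (q / (k + 1))) `^ ((k + 1) / (q -
    1)))
     `^ (q - 1).

Lemma ae_neq (v : T) : {ae leb, forall w : T, w != v}.
Proof.
exists [set v]; split => //; first exact: lebesgue_measure_set1.
by move=> w /= /negP; rewrite negbK => /eqP.
Qed.

(** The shift t -> t - x v turns the integral over t into a correlation at the
    lag x (w - v); integrating over x then produces the factor 1 / |w - v|. *)
Lemma correlation_bound (q k : R) (g : T -> T ->
  \bar R) (v w : T) : (0 < q)%R ->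
  (1 <= k)%R -> mnn (fun p : T * T => g p.1 p.2) -> w != v ->
  (\int[leb]_x (\int[leb]_t (g v (t + x * v)%R * g w (t + x * w)%R) `^ (q / k /
    2))
     `^ k) `^ (2 / q) <=
  (\int[leb]_t g v t `^ (q / (k + 1))) `^ ((k + 1) / q) *
  (\int[leb]_t g w t `^ (q / (k + 1))) `^ ((k + 1) / q) *
  (`|w - v| `^ (- (2 / q)))%:E.
Proof.
move=> q0 k1 mg wv.
have k0 : (0 < k)%R by exact: lt_le_trans k1.
have kp0 : (0 < k + 1)%R by rewrite addr_gt0.
have wv0 : (w - v != 0)%R by rewrite subr_eq0.
pose a := (q / (k + 1))%R.
have mv : mnn (fun t => g v t `^ a) by solve_mnn.
have mw : mnn (fun t => g w t `^ a) by solve_mnn.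
pose B (r : T) := \int[leb]_t ((g v t `^ a) `^ ((k + 1) / (2 * k)) *
     (g w (t + r)%R `^ a) `^ ((k + 1) / (2 * k))).
have mB : mnn B by rewrite /B; solve_mnn.
have E x : \int[leb]_t (g v (t + x * v)%R * g w (t + x * w)%R) `^ (q / k / 2) =
    B ((w - v) * x)%R.
  rewrite /B.
  have mI : mnn (fun t : T => (g v t `^ a) `^ ((k + 1) / (2 * k)) *
     (g w (t + (w - v) * x)%R `^ a) `^ ((k + 1) / (2 * k))) by solve_mnn.
  rewrite -(int_shift (x * v)%R mI); apply: eq_integral => t _.
  rewrite -!poweRrM poweRM.
  - have -> : (a * ((k + 1) / (2 * k)) = q / k / 2)%R.
      by rewrite /a; field; rewrite !gt_eqF.
    by congr (_ * (g _ _ `^ _)); ring.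
  - exact: (mnn_ge0 (v, _) mg).
  - exact: (mnn_ge0 (w, _) mg).
under eq_integral do rewrite E.
rewrite (int_scale wv0 (mnnX k mB)).
have I0 (u : T) : 0 <= \int[leb]_t g u t `^ a.
  by apply: integral_ge0 => t _; exact: poweR_ge0.
have IB0 : 0 <= \int[leb]_r B r `^ k.
  by apply: integral_ge0 => r _; exact: poweR_ge0.
have V0 : 0 <= (`|(w - v)%R|^-1)%:E by rewrite lee_fin invr_ge0.
have q20 : (0 <= 2 / q)%R by rewrite divr_ge0// ltW.
apply: (@le_trans _ _ (((`|(w - v)%R|^-1)%:E *
   ((\int[leb]_t g v t `^ a) `^ ((k + 1) / 2) *
    (\int[leb]_t g w t `^ a) `^ ((k + 1) / 2))) `^ (2 / q))).
  apply: le_poweR => //; first exact: mule_ge0.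
  apply: lee_wpmul2l => //.
  exact: young_correlation.
rewrite !poweRM ?mule_ge0 ?poweR_ge0//.
rewrite muleC -!poweRrM.
have -> : ((k + 1) / 2 * (2 / q) = (k + 1) / q)%R by field; rewrite gt_eqF.
apply: lee_wpmul2l; first by rewrite mule_ge0 ?poweR_ge0.
by rewrite poweR_EFin lee_fin -(powR_inv1 (normr_ge0 _)) -powRrM mulN1r.
Qed.

(** Minkowski's inequality is used with the exponents q / (2k) in t and q / 2
    in x, whence the hypothesis 2 k <= q. *)
Lemma radon1_bound_direct (q k : R) : (2 < q)%R -> (1 <= k)%R ->
  (2 * k <= q)%R ->
  radon1_bound q k.
Proof.
move=> q2 k1 kq; have [C0 C00 hlsP] := hardy_littlewood_sobolev q2.
have q0 : (0 < q)%R by exact: lt_trans q2.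
have k0 : (0 < k)%R by exact: lt_le_trans k1.
have q1 : (0 < q - 1)%R by rewrite subr_gt0 (lt_trans _ q2)// ltr1n.
exists (C0 `^ (q / 2))%R; first by rewrite powR_gt0.
move=> g mg.
have g0 x y : 0 <= g x y by exact: (mnn_ge0 (x, y) mg).
have mS := mnn_radon1 mg.
have S0 x t : 0 <= radon1 g x t by exact: (mnn_ge0 (x, t) mS).
pose P x v w (t : T) := g v (t + x * v)%R * g w (t + x * w)%R.
pose r := (q / k / 2)%R.
have r1 : (1 <= r)%R by rewrite /r ler_pdivlMr// mul1r ler_pdivlMr.
have r0 : (0 < r)%R by exact: lt_le_trans r1.
have q21 : (1 <= q / 2)%R by rewrite ler_pdivlMr// mul1r ltW.
pose A x v w := \int[leb]_t P x v w t `^ r.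
have A0 x v w : 0 <= A x v w by apply: integral_ge0 => t _; exact: poweR_ge0.
have mA : mnn (fun p : T * T * T => A p.1.1 p.1.2 p.2).
  by rewrite /A /P; solve_mnn.
have Sq x t : radon1 g x t `^ (q / k) =
    (\int[leb]_v \int[leb]_w P x v w t) `^ r.
  rewrite (_ : q / k = 2 * r)%R; last by rewrite /r; field; rewrite gt_eqF.
  rewrite poweRrM poweR_sqr//; congr (_ `^ _).
  rewrite {1}/radon1 -intZr//; last by solve_mnn.
  apply: eq_integral => v _; rewrite /P intZl//.
  by solve_mnn.
have st1 x : (\int[leb]_t radon1 g x t `^ (q / k)) `^ k <=
    (\int[leb]_v \int[leb]_w A x v w `^ r^-1) `^ (q / 2).
  under eq_integral do rewrite Sq.
  have mP : mnn (fun p : T * T * T => P x p.1.2 p.2 p.1.1) by rewrite /P;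
    solve_mnn.
  have := minkowski_integral2 leb leb leb (F := fun t v w => P x v w t) mP r1.
  move=> /(le_poweR (ltW k0) (integral_ge0 _ (fun t _ => poweR_ge0 _ _))).
  rewrite -poweRrM (_ : r * k = q / 2)%R//.
  by rewrite /r; field; rewrite gt_eqF.
pose G v := (\int[leb]_t g v t `^ (q / (k + 1))) `^ ((k + 1) / q).
have mG : mnn G by rewrite /G; solve_mnn.
have mAr : mnn (fun p : T * T * T => A p.1.1 p.1.2 p.2 `^ r^-1) by solve_mnn.
have mL : mnn (fun x => (\int[leb]_t radon1 g x t `^ (q / k)) `^ k) by
  solve_mnn.
have mM : mnn (fun x => (\int[leb]_v \int[leb]_w A x v w `^ r^-1) `^ (q / 2)).
  by solve_mnn.
apply: (le_trans (le_int leb mL mM st1)).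
apply: (le_trans (minkowski_integral2 leb leb leb (F :=
  fun x v w => A x v w `^ r^-1) mAr q21)).
rewrite -poweR_EFin.
have -> : (\int[leb]_v (\int[leb]_t g v t `^ (q / (k + 1))) `^ ((k + 1) / (q -
  1)))
     `^ (q - 1) =
   ((\int[leb]_v G v `^ (q / (q - 1))) `^ (2 * (q - 1) / q)) `^ (q / 2).
  rewrite -poweRrM (_ : 2 * (q - 1) / q * (q / 2) = q - 1)%R; last first.
    by field; rewrite gt_eqF.
  congr (_ `^ _); apply: eq_integral => v _; rewrite /G -poweRrM.
  by congr (_ `^ _); field; rewrite !gt_eqF.
have I0 : 0 <= \int[leb]_v G v `^ (q / (q - 1)).
  by apply: integral_ge0 => v _; exact: poweR_ge0.
rewrite -poweRM ?poweR_ge0//; last by rewrite lee_fin ltW.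
apply: le_poweR; first by rewrite divr_ge0// ltW.
  by apply: integral_ge0 => v _; apply: integral_ge0 => w _; exact: poweR_ge0.
apply: le_trans (hlsP G mG).
have mR : mnn (fun p : T * T => G p.1 * G p.2 * (`|p.2 - p.1| `^ (- (2 /
  q)))%:E).
  by solve_mnn.
have mAk : mnn (fun p : T * T =>
    (\int[leb]_x (A x p.1 p.2 `^ r^-1) `^ (q / 2)) `^ (q / 2)^-1) by solve_mnn.
apply: le_int; [by solve_mnn|by solve_mnn|move=> v].
apply: ae_le_int; [by solve_mnn|by solve_mnn|].
apply: filterS (ae_neq v) => w wv.
have -> : ((q / 2)^-1 = 2 / q)%R by field; rewrite gt_eqF.
under eq_integral do rewrite -poweRrM.
have -> : (r^-1 * (q / 2) = k)%R by rewrite /r; field; rewrite !gt_eqF.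
exact: correlation_bound.
Qed.

End radon1_direct.

Section dual.
Context {R : realType}.
Notation T := (measurableTypeR R).
Notation leb := (@lebesgue_measure R).

Lemma nondecreasing_le_limn (u : nat ->
  \bar R) n : {homo u : m n / (m <= n)%N >-> m <= n} ->
  u n <= limn u.
Proof.
move=> ndu; have cu : cvgn u by exact: ereal_nondecreasing_is_cvgn.
by apply: lime_ge => //; exists n => // m /= nm; exact: ndu.
Qed.

Lemma poweR_limn (u : nat -> \bar R) (r : R) : (0 < r)%R ->
  (forall n, 0 <= u n) -> {homo u : m n / (m <= n)%N >-> m <= n} ->
  (limn u) `^ r <= limn (fun n => u n `^ r).
Proof.
move=> r0 u0 ndu.
have ndur : {homo (fun n => u n `^ r) : m n / (m <= n)%N >-> m <= n}.
  by move=> m n mn; apply: le_poweR => //; [exact: ltW|exact: ndu].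
have lu0 : 0 <= limn u by apply: le_trans (nondecreasing_le_limn 0 ndu).
have lur0 : 0 <= limn (fun n => u n `^ r).
  by apply: le_trans (nondecreasing_le_limn 0 ndur); exact: poweR_ge0.
rewrite -[leRHS](poweRVK (lt0r_neq0 r0))//; apply: le_poweR => //;
  first exact: ltW.
apply: lime_le; first exact: ereal_nondecreasing_is_cvgn.
apply: nearW => n; rewrite -[leLHS](poweRK (lt0r_neq0 r0))//.
apply: le_poweR; [by rewrite invr_ge0 ltW|exact: poweR_ge0|].
exact: (nondecreasing_le_limn n ndur).
Qed.

Lemma limn_int d (X : measurableType d) (mu : {measure set X -> \bar R})
    (f : nat -> X -> \bar R) : (forall n, mnn (f n)) ->
  (forall x, {homo f ^~ x : m n / (m <= n)%N >-> m <= n}) ->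
  \int[mu]_x limn (fun n => f n x) = limn (fun n => \int[mu]_x f n x).
Proof.
move=> mf ndf; rewrite -monotone_convergence => [//|//|n|n x _|x _ m n mn].
- by have [] := mf n.
- exact: mnn_ge0.
- exact: ndf.
Qed.

(** Finiteness of X is essential here: this is how an estimate of X by a power
    of itself, obtained by testing against X's own extremizer, is turned into
    an a priori bound. *)
Lemma le_absorb (X K : \bar R) (q : R) : (1 < q)%R -> 0 <= X -> X < +oo ->
  0 <= K ->
  X <= K * X `^ ((q - 1) / q) -> X <= K `^ q.
Proof.
move=> q1 X0 Xy K0 h.
have q0 : (0 < q)%R by exact: lt_trans q1.
have [->|XN0] := eqVneq X 0; first exact: poweR_ge0.
have [->|Ky] := eqVneq K +oo; first by rewrite poweRyr ?gt_eqF// leey.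
move: X K X0 Xy XN0 K0 Ky h => [x| |]// [k| |]//.
rewrite lee_fin eqe => x0 _ xN0 k0 _; rewrite !poweR_EFin -EFinM !lee_fin => h.
have {xN0}x0 : (0 < x)%R by rewrite lt0r xN0.
have xE : (x = x `^ q^-1 * x `^ ((q - 1) / q))%R.
  rewrite -powRD; last by rewrite (gt_eqF x0) implybT.
  rewrite -[LHS](powRr1 (ltW x0)); congr (_ `^ _)%R.
  by field; rewrite gt_eqF.
rewrite {1}xE ler_pM2r ?powR_gt0// in h.
have := ge0_ler_powR (ltW q0) _ _ h.
rewrite !nnegrE powR_ge0 lee_fin in k0 * => /(_ isT k0).
by rewrite -powRrM mulVf ?gt_eqF// powRr1// ltW.
Qed.

(** The substitution s = t + x v. The adjoint is again the same transform, up
    to the reflection v -> - v. *)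
Lemma radon1_adjoint (g w : T -> T -> \bar R) :
  mnn (fun p : T * T => g p.1 p.2) -> mnn (fun p : T * T => w p.1 p.2) ->
  \int[leb]_x \int[leb]_t (radon1 g x t * w x t) =
  \int[leb]_v \int[leb]_s (g v s * radon1 w (- v)%R s).
Proof.
move=> mg mw; rewrite /radon1.
have g0 x y : 0 <= g x y by exact: (mnn_ge0 (x, y) mg).
have w0 x y : 0 <= w x y by exact: (mnn_ge0 (x, y) mw).
transitivity (\int[leb]_x \int[leb]_v \int[leb]_s (g v s * w x (s - x * v)%R)).
  apply: eq_integral => x _.
  transitivity (\int[leb]_t \int[leb]_v (g v (t + x * v)%R * w x t)).
    by apply: eq_integral => t _; rewrite intZr//; solve_mnn.
  rewrite tonelli; last by solve_mnn.
  apply: eq_integral => v _.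
  have m1 : mnn (fun s => g v s * w x (s - x * v)%R) by solve_mnn.
  rewrite -(int_shift (x * v)%R m1); apply: eq_integral => t _.
  by rewrite addrK.
rewrite tonelli; last by solve_mnn.
apply: eq_integral => v _; rewrite tonelli; last by solve_mnn.
apply: eq_integral => s _; rewrite intZl//; last by solve_mnn.
by congr (_ * _); apply: eq_integral => x _; rewrite mulNr mulrC.
Qed.

Section radon1_dual.
Variables (q k : R).
Hypotheses (q2 : (2 < q)%R) (k1 : (1 <= k)%R) (k'1 : (1 <= q - 1 - k)%R).
Variables (C : R).
Hypothesis C0 : (0 < C)%R.
Hypothesis dualP : forall g : T -> T ->
  \bar R, mnn (fun p : T * T => g p.1 p.2) ->
  \int[leb]_x (\int[leb]_t radon1 g x t `^ (q / (q - 1 - k))) `^ (q - 1 - k) <=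
  C%:E * (\int[leb]_v (\int[leb]_t g v t `^ (q / (q - 1 - k + 1)))
     `^ ((q - 1 - k + 1) / (q - 1))) `^ (q - 1).

Let q0 : (0 < q)%R. Proof. exact: lt_trans q2. Qed.
Let q1 : (0 < q - 1)%R. Proof. by rewrite subr_gt0 (lt_trans _ q2)// ltr1n. Qed.
Let k0 : (0 < k)%R. Proof. exact: lt_le_trans k1. Qed.
Let qk0 : (0 < q - k)%R. Proof. by move: k'1; lra. Qed.

(** Hoelder's inequality in s and then in v, followed by the bound for the
    adjoint: the exponents q / (k + 1) and q / (q - 1 - k) are conjugate. *)
Lemma radon1_pairing_le (g w : T -> T -> \bar R) :
  mnn (fun p : T * T => g p.1 p.2) -> mnn (fun p : T * T => w p.1 p.2) ->
  \int[leb]_x \int[leb]_t (radon1 g x t * w x t) <=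
  (\int[leb]_v (\int[leb]_t g v t `^ (q / (k + 1))) `^ ((k + 1) / (q - 1)))
     `^ ((q - 1) / q) *
  (C%:E * (\int[leb]_v (\int[leb]_t w v t `^ (q / (q - k)))
     `^ ((q - k) / (q - 1))) `^ (q - 1)) `^ q^-1.
Proof.
move=> mg mw; rewrite radon1_adjoint//.
have g0 x y : 0 <= g x y by exact: (mnn_ge0 (x, y) mg).
have w0 x y : 0 <= w x y by exact: (mnn_ge0 (x, y) mw).
have mS := mnn_radon1 mw.
have S0 x y : 0 <= radon1 w x y by exact: (mnn_ge0 (x, y) mS).
pose k' := (q - 1 - k)%R.
have k'0 : (0 < k')%R by exact: lt_le_trans k'1.
have kp0 : (0 < k + 1)%R by rewrite addr_gt0.
pose a := (q / (k + 1))%R; pose a' := (q / k')%R.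
have a0 : (0 < a)%R by rewrite divr_gt0.
have a'0 : (0 < a')%R by rewrite divr_gt0.
pose Phi v := \int[leb]_s g v s `^ a.
pose Psi v := \int[leb]_s radon1 w (- v)%R s `^ a'.
have mPhi : mnn Phi by rewrite /Phi; solve_mnn.
have mPsi : mnn Psi by rewrite /Psi; solve_mnn.
have inner v : \int[leb]_s (g v s * radon1 w (- v)%R s) <=
    Phi v `^ a^-1 * Psi v `^ a'^-1.
  have mgv : mnn (fun s => g v s `^ a) by solve_mnn.
  have mwv : mnn (fun s => radon1 w (- v)%R s `^ a') by solve_mnn.
  have -> : \int[leb]_s (g v s * radon1 w (- v)%R s) =
      \int[leb]_s ((g v s `^ a) `^ a^-1 * (radon1 w (- v)%R s `^ a') `^ a'^-1).
    by apply: eq_integral => s _; rewrite !poweRK ?gt_eqF.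
  apply: hoelder_geometric => //; rewrite ?invr_ge0 ?ltW//.
  by rewrite /a /a' /k'; field; rewrite !gt_eqF.
have m1 : mnn (fun v => \int[leb]_s (g v s * radon1 w (- v)%R s)) by solve_mnn.
have m2 : mnn (fun v => Phi v `^ a^-1 * Psi v `^ a'^-1) by solve_mnn.
apply: (le_trans (le_int leb m1 m2 inner)).
have -> : \int[leb]_v (Phi v `^ a^-1 * Psi v `^ a'^-1) =
   \int[leb]_v ((Phi v `^ ((k + 1) / (q - 1))) `^ ((q - 1) / q) *
     (Psi v `^ k') `^ q^-1).
  apply: eq_integral => v _; rewrite -!poweRrM; congr (_ `^ _ * _ `^ _).
    by rewrite /a; field; rewrite !gt_eqF.
  by rewrite /a'; field; rewrite !gt_eqF.
apply: (le_trans (hoelder_geometric leb (mnnX _ mPhi) (mnnX _ mPsi) _ _ _)).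
- by rewrite divr_ge0// ltW.
- by rewrite invr_ge0 ltW.
- by field; rewrite gt_eqF.
apply: lee_wpmul2l; first exact: poweR_ge0.
apply: le_poweR; first by rewrite invr_ge0 ltW.
  by apply: integral_ge0 => v _; exact: poweR_ge0.
have mL : mnn (fun v : T => (\int[leb]_s radon1 w v s `^ a') `^ k') by
  solve_mnn.
have -> : \int[leb]_v Psi v `^ k' =
    \int[leb]_v (\int[leb]_s radon1 w v s `^ a') `^ k'.
  have := int_scale (c := -1) (f :=
    fun v => (\int[leb]_s radon1 w v s `^ a') `^ k').
  rewrite oppr_eq0 oner_eq0 normrN normr1 invr1 mul1e => /(_ isT mL) <-.
  by apply: eq_integral => v _; rewrite mulN1r.
have := dualP mw.
by rewrite (_ : q - 1 - k + 1 = q - k)%R//; ring.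
Qed.

Variable g : T -> T -> \bar R.
Hypothesis mg : mnn (fun p : T * T => g p.1 p.2).
Let mS := mnn_radon1 mg.
Let S0 x t : 0 <= radon1 g x t. Proof. exact: (mnn_ge0 (x, t) mS). Qed.

(** Truncations of S g, in height and in the plane, so that their mixed norms
    are finite. *)
Let h n x t : \bar R := if (`|x| <= n%:R)%R then
  if (`|t| <= n%:R)%R then mine (radon1 g x t) n%:R%:E else 0 else 0.

Let mh n : mnn (fun p : T * T => h n p.1 p.2).
Proof.
apply: mnn_if; [by solve_meas| |exact: mnn_cst].
apply: mnn_if; [by solve_meas| |exact: mnn_cst].
split; last by move=> x; rewrite le_min S0 lee_fin ler0n.
by have [mS1 _] := mS; exact: measurable_mine.
Qed.

Let h0 n x t : 0 <= h n x t. Proof. exact: (mnn_ge0 (x, t) (mh n)). Qed.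

Let hS n x t : h n x t <= radon1 g x t.
Proof. by rewrite /h; do 2 (case: ifP => // _); rewrite ge_min lexx. Qed.

Let ndh x t : {homo h ^~ x ^~ t : m n / (m <= n)%N >-> m <= n}.
Proof.
move=> m n mn; have mnR : (m%:R <= n%:R :> R)%R by rewrite ler_nat.
rewrite [leLHS]/h; case: ifPn => // xm; case: ifPn => // tm.
rewrite /h (le_trans xm mnR) (le_trans tm mnR).
by rewrite le_min !ge_min lexx/= lee_fin mnR orbT.
Qed.

Let limh x t : radon1 g x t <= limn (fun n => h n x t).
Proof.
(* from N0 on, the point (x, t) lies in the truncating square *)
pose N0 := (Num.truncn `|x| + Num.truncn `|t|)%N.+1.
have hN n : (N0 <= n)%N -> h n x t = mine (radon1 g x t) n%:R%:E.
  move=> N0n; rewrite /h.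
  have -> : (`|x| <= n%:R)%R.
    apply: (le_trans (ltW (truncnS_gt `|x|%R))).
    by rewrite ler_nat (leq_trans _ N0n)// ltnS leq_addr.
  have -> // : (`|t| <= n%:R)%R.
  apply: (le_trans (ltW (truncnS_gt `|t|%R))).
  by rewrite ler_nat (leq_trans _ N0n)// ltnS leq_addl.
have le_h n : h n x t <= limn (fun n => h n x t) by apply:
  (nondecreasing_le_limn n (ndh x t)).
have := S0 x t; case E : (radon1 g x t) => [s| |]// s0.
  pose n := (N0 + (Num.truncn s).+1)%N.
  apply: le_trans (le_h n); rewrite hN ?leq_addr// E le_min lexx/= lee_fin.
  apply: (le_trans (ltW (truncnS_gt s))).
  by rewrite ler_nat leq_addl.
rewrite leye_eq; apply/eqP.
case L : (limn _) => [l| |]//.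
  pose n := (N0 + (Num.truncn l).+1)%N.
  have := le_h n; rewrite hN ?leq_addr// E L minye lee_fin leNgt.
  by rewrite (lt_le_trans (truncnS_gt l))// ler_nat leq_addl.
by have := le_h 0%N; rewrite L leeNy_eq => /eqP h00; have := h0 0 x t;
  rewrite h00.
Qed.

Let b := (q / k)%R.
Let b0 : (0 < b)%R. Proof. by rewrite divr_gt0. Qed.
Let b1 : (0 < b - 1)%R. 
Proof. by rewrite subr_gt0 /b ltr_pdivlMr// mul1r; move: qk0; lra. Qed.
Let Y n x := \int[leb]_t h n x t `^ b.
Let mY n : mnn (Y n).
Proof. by rewrite /Y; have := mh n => H; solve_mnn. Qed.
Let Y0 n x : 0 <= Y n x. Proof. exact: mnn_ge0. Qed.
Let ndY x : {homo Y ^~ x : m n / (m <= n)%N >-> m <= n}.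
Proof.
move=> m n mn; have H1 := mh n; have H2 := mh m.
apply: le_int; [by solve_mnn|by solve_mnn|move=> t].
by apply: le_poweR => //; [exact: ltW|exact: ndh].
Qed.
Let X n := \int[leb]_x Y n x `^ k.

Let Xfin n : X n < +oo.
Proof.
pose M : R := (n%:R `^ b * (2 * n%:R))%R.
have M0 : (0 <= M)%R by rewrite mulr_ge0 ?powR_ge0 ?mulr_ge0.
have mball (c : R) : (0 <= c)%R ->
    mnn (fun t : T => (if `|t|%R <= n%:R then c else 0)%R%:E).
  move=> c0; apply: mnn_EFin; last by move=> x; case: ifP.
  by apply: measurable_fun_ifT => //; solve_meas.
have Iball (c : R) : (0 <= c)%R ->
    \int[leb]_t (if `|t|%R <= n%:R then c else 0)%R%:E = (c * (2 * n%:R))%:E.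
  move=> c0; rewrite EFinM -int_ball ?ler0n// -intZl ?lee_fin//;
    last exact: mball.
  by apply: eq_integral => t _; case: ifP; rewrite -EFinM ?mulr1 ?mulr0.
have YM x : Y n x <= (if `|x|%R <= n%:R then M else 0)%R%:E.
  rewrite /Y; case: ifPn => xn; last first.
    rewrite integral0_eq// => t _.
    by rewrite /h (negbTE xn) poweR0r// gt_eqF.
  rewrite /M -Iball ?powR_ge0//.
  have H1 := mh n.
  apply: le_int; [by solve_mnn|by apply: mball; exact: powR_ge0|move=> t].
  rewrite /h xn; case: ifP => _; last by rewrite poweR0r// gt_eqF.
  rewrite -poweR_EFin; apply: le_poweR; first exact: ltW.
    by rewrite le_min S0 lee_fin ler0n.
  by rewrite ge_min lexx orbT.
apply: (@le_lt_trans _ _ (M `^ k * (2 * n%:R))%:E); last exact: ltry.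
rewrite -Iball ?powR_ge0//.
apply: le_int; [exact: (mnnX k (mY n))|by apply: mball;
  exact: powR_ge0|move=> x].
apply: (le_trans (le_poweR (ltW k0) (Y0 n x) (YM x))).
by case: ifP => _//; rewrite poweR0r// gt_eqF.
Qed.

Let Gam := \int[leb]_v (\int[leb]_t g v t `^ (q / (k + 1))) `^ ((k + 1) / (q -
  1)).
Let Gam0 : 0 <= Gam. Proof. by apply: integral_ge0 => v _;
  exact: poweR_ge0. Qed.

(** Test the transform against w = h^(b-1) Y^(k-1), the function that
    extremizes the pairing of h with the unit ball of the dual mixed space, up
    to a factor. Its own dual norm is a power of X, so that X is bounded by a
    smaller power of X. *)
Let Xbound n : X n <= C%:E * Gam `^ (q - 1).
Proof.
have H1 := mh n; have H2 := mY n.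
have X0 : 0 <= X n by apply: integral_ge0 => x _; exact: poweR_ge0.
pose w x t := h n x t `^ (b - 1) * Y n x `^ (k - 1).
have mw : mnn (fun p : T * T => w p.1 p.2) by rewrite /w; solve_mnn.
have key : X n <= Gam `^ ((q - 1) / q) * (C%:E * X n `^ (q - 1)) `^ q^-1.
  have -> : X n `^ (q - 1) = (\int[leb]_v (\int[leb]_t w v t `^ (q / (q - k)))
     `^ ((q - k) / (q - 1))) `^ (q - 1).
    congr (_ `^ _); apply: eq_integral => x _.
    rewrite /w; under eq_integral do rewrite poweRM ?poweR_ge0// -!poweRrM.
    rewrite intZr ?poweR_ge0//; last by solve_mnn.
    have -> : ((b - 1) * (q / (q - k)) = b)%R.
      by rewrite /b; field; rewrite !gt_eqF.
    rewrite -/(Y n x) poweRM ?poweR_ge0// -poweRrM -poweRD_ge0; last first.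
    - by rewrite !mulr_ge0 ?invr_ge0 ?(ltW qk0) ?(ltW q1) ?(ltW q0)// subr_ge0.
    - by rewrite divr_ge0// ltW.
    by congr (_ `^ _); field; rewrite !gt_eqF.
  apply: le_trans (radon1_pairing_le mg mw).
  apply: le_int; [by solve_mnn|by solve_mnn|move=> x].
  have -> : Y n x `^ k = \int[leb]_t (h n x t `^ b * Y n x `^ (k - 1)).
    rewrite intZr ?poweR_ge0//; last by solve_mnn.
    rewrite -/(Y n x) -[X in X * _](poweRe1 (Y0 n x)) -poweRD_ge0 ?subr_ge0//.
    by rewrite addrC subrK.
  have Ha : mnn (fun t => h n x t `^ b * Y n x `^ (k - 1)).
    solve_mnn.
  have Hb : mnn (fun t => radon1 g x t * w x t).
    solve_mnn.
  apply: (le_int leb Ha Hb) => t.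
  rewrite /w muleA; apply: lee_wpmul2r; first exact: poweR_ge0.
  have -> : h n x t `^ b = h n x t * h n x t `^ (b - 1).
    rewrite -[X in _ = X * _](poweRe1 (h0 n x t)) -poweRD_ge0 ?(ltW b1)//.
    by rewrite addrC subrK.
  by apply: lee_wpmul2r => //; exact: poweR_ge0.
(* the constant of [key] for which [le_absorb] applies *)
pose K := Gam `^ ((q - 1) / q) * (C `^ q^-1)%:E.
have K0 : 0 <= K by rewrite mule_ge0 ?poweR_ge0// lee_fin powR_ge0.
have -> : C%:E * Gam `^ (q - 1) = K `^ q.
  rewrite /K poweRM ?poweR_ge0 ?lee_fin ?powR_ge0// -poweRrM divfK ?gt_eqF//.
  by rewrite poweR_EFin -powRrM mulVf ?gt_eqF// powRr1 ?(ltW C0)// muleC.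
apply: le_absorb => //; first by move: q1; rewrite subr_gt0.
apply: (le_trans key); rewrite poweRM ?poweR_ge0 ?lee_fin ?(ltW C0)//.
by rewrite /K -muleA -poweRrM.
Qed.

(** Duality gives the bound for the truncations, uniformly; the monotone
    convergence theorem, applied in t and then in x, removes them. *)
Lemma radon1_bound_dual :
  \int[leb]_x (\int[leb]_t radon1 g x t `^ b) `^ k <= C%:E * Gam `^ (q - 1).
Proof.
have ndhb x t : {homo (fun n => h n x t `^ b) : m n / (m <= n)%N >-> m <= n}.
  by move=> m n mn; apply: le_poweR => //; [exact: ltW|exact: ndh].
have ndYk x : {homo (fun n => Y n x `^ k) : m n / (m <= n)%N >-> m <= n}.
  by move=> m n mn; apply: le_poweR => //; [exact: ltW|exact: ndY].
have mlim (d : measure_display) (Z : measurableType d) (f : nat -> Z ->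
  \bar R) :
    (forall n, mnn (f n)) ->
    (forall x, {homo f ^~ x : m n / (m <= n)%N >-> m <= n}) ->
    mnn (fun x => limn (fun n => f n x)).
  move=> mf ndf; split; last first.
    by move=> x; apply: le_trans (nondecreasing_le_limn 0 (ndf x));
      exact: mnn_ge0.
  apply: (emeasurable_fun_cvg f) => [n|x _]; first by have [] := mf n.
  exact: ereal_nondecreasing_is_cvgn.
have mhb n x : mnn (fun t => h n x t `^ b) by have H := mh n; solve_mnn.
have mYk n : mnn (fun x => Y n x `^ k) by apply: mnnX.
have st x : (\int[leb]_t radon1 g x t `^ b) `^ k <= limn (fun n => Y n x `^ k).
  apply: le_trans (poweR_limn k0 (Y0 ^~ x) (ndY x)).
  apply: le_poweR; first exact: ltW.
    by apply: integral_ge0 => t _; exact: poweR_ge0.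
  rewrite /Y -(@limn_int _ _ leb (fun n t => h n x t `^ b) (mhb ^~ x) (ndhb x)).
  have ml : mnn (fun t => limn (fun n => h n x t `^ b)).
    apply: (mlim _ _ (fun n t => h n x t `^ b)) => [n|t]; first exact: mhb.
    exact: ndhb.
  apply: le_int; [by solve_mnn|exact: ml|move=> t].
  apply: le_trans (poweR_limn b0 (fun n => h0 n x t) (ndh x t)).
  by apply: le_poweR => //; exact: ltW.
apply: (@le_trans _ _ (\int[leb]_x limn (fun n => Y n x `^ k))).
  apply: le_int; [by solve_mnn| |exact: st].
  apply: (mlim _ _ (fun n x => Y n x `^ k)) => [n|x]; first exact: mYk.
  exact: ndYk.
rewrite (@limn_int _ _ leb (fun n x => Y n x `^ k) mYk ndYk); apply: lime_le;
  last by apply: nearW; exact: Xbound.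
apply: ereal_nondecreasing_is_cvgn => m n mn.
by apply: (le_int leb (mYk m) (mYk n)) => x; exact: ndYk.
Qed.

End radon1_dual.

Lemma radon1_bounded (q k : R) : (2 < q)%R -> (1 <= k)%R -> (k <= q - 2)%R ->
  radon1_bound q k.
Proof.
move=> q2 k1 kq.
have [kq2|kq2] := leP (2 * k)%R q; first exact: radon1_bound_direct.
have k'1 : (1 <= q - 1 - k)%R by lra.
have [|C C0 CP] := @radon1_bound_direct R q (q - 1 - k) q2 k'1; first by lra.
exists C => // g mg.
exact: (radon1_bound_dual q2 k1 k'1 C0 CP mg).
Qed.

End dual.

(** * The Radon transform in several variables *)

Section tuple_integral.
Context {R : realType}.
Notation T := (measurableTypeR R).
Notation leb := (@lebesgue_measure R).
Notation ltup m := (@lebesgue_tuple R m).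

Lemma int_tuple0 (f : 'euc[R]_0 -> \bar R) : mnn f ->
  \int[ltup 0]_x f x = f [tuple].
Proof.
move=> [mf f0]; rewrite /lebesgue_tuple /= integral_dirac//.
by rewrite diracT mul1e.
Qed.

Lemma int_tupleS m (f : 'euc[R]_m.+1 -> \bar R) : mnn f ->
  \int[ltup m.+1]_x f x = \int[leb]_a \int[ltup m]_x f (cons_pair (a, x)).
Proof.
move=> [mf f0].
have mfc : mnn (fun z : T * 'euc[R]_m => f (cons_pair z)).
  split=> //; apply: measurableT_comp => //; exact: measurable_cons_pair.
transitivity (\int[(leb \x lebesgue_rec R m)]_z f (cons_pair z)).
  rewrite /lebesgue_tuple /= /lebesgue_cons.
  rewrite ge0_integral_pushforward//.
  exact: measurable_cons_pair.
rewrite fubini_tonelli1//; first by have [] := mfc.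
Qed.

Lemma dot_cons m (a b : R) (x v : 'euc[R]_m) :
  dot (cons_pair (a, x)) (cons_pair (b, v)) = (a * b + dot x v)%R.
Proof.
rewrite /dot big_ord_recl !tnth_cons_pair0; congr (_ + _)%R.
by apply: eq_bigr => i _; rewrite !tnth_cons_pairS.
Qed.

Lemma dot0 (x v : 'euc[R]_0) : dot x v = 0%R.
Proof. by rewrite /dot big_ord0. Qed.

Definition radon m (g : 'euc[R]_m -> T -> \bar R) (x : 'euc[R]_m) (t : T) :=
  \int[ltup m]_v g v (t + dot x v)%R.

Lemma mnn_radon m (g : 'euc[R]_m -> T -> \bar R) :
  mnn (fun p : 'euc[R]_m * T => g p.1 p.2) ->
  mnn (fun p : 'euc[R]_m * T => radon g p.1 p.2).
Proof. by move=> mg; rewrite /radon; solve_mnn. Qed.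

(** The transform in m + 1 variables is the one in the first variable, with
    values in functions of the m others, followed by the one in the others. The
    induction hypothesis bounds the latter for each x0. The norm in x0 is then
    taken inside the integral over v' by Minkowski's inequality with exponent
    q/p = q - 1, and the former is bounded for each v' by the one-variable
    estimate. *)
Lemma radon_mixed (q : R) m : (2 < q)%R -> (m%:R <= q - 2)%R ->
  exists2 C : R, (0 < C)%R &
  forall g : 'euc[R]_m -> T ->
    \bar R, mnn (fun p : 'euc[R]_m * T => g p.1 p.2) ->
  \int[ltup m]_x \int[leb]_t radon g x t `^ q <=
  C%:E * (\int[ltup m]_v (\int[leb]_t g v t `^ (q / m.+1%:R))
    `^ (m.+1%:R / (q - 1))) `^ (q - 1).
Proof.
move=> q2.
have q0 : (0 < q)%R by exact: lt_trans q2.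
have q1 : (0 < q - 1)%R by rewrite subr_gt0 (lt_trans _ q2)// ltr1n.
have q11 : (1 <= q - 1)%R by lra.
elim: m => [_|m IH mq].
  exists 1%R => // g mg; rewrite mul1e.
  have mR := mnn_radon mg.
  rewrite !int_tuple0; [|by solve_mnn|by solve_mnn].
  rewrite divr1 -poweRrM mul1r mulVf ?gt_eqF// poweRe1; last first.
    by apply: integral_ge0 => t _; exact: poweR_ge0.
  rewrite le_eqVlt; apply/orP; left; apply/eqP; apply: eq_integral => t _.
  rewrite /radon int_tuple0; last by solve_mnn.
  by rewrite dot0 addr0.
have [|C C0 CP] := IH; first by apply: le_trans mq; rewrite ler_nat.
have m1 : (1 <= m.+1%:R :> R)%R by rewrite ler1n.
have [C1 C10 C1P] := radon1_bounded q2 m1 mq.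
have m0 : (0 < m.+1%:R :> R)%R by exact: lt_le_trans m1.
exists (C * C1)%R; first exact: mulr_gt0.
move=> g mg.
pose F (x0 : T) (v' : 'euc[R]_m) (s : T) :=
  radon1 (fun v0 => g (cons_pair (v0, v'))) x0 s.
have mF : mnn (fun p : T * 'euc[R]_m * T => F p.1.1 p.1.2 p.2).
  by rewrite /F /radon1; solve_mnn.
have mR := mnn_radon mg.
pose RF x0 x' t := radon (F x0) x' t.
have mRF : mnn (fun p : T * 'euc[R]_m * T => RF p.1.1 p.1.2 p.2).
  by rewrite /RF /radon; solve_mnn.
have E x0 x' t : radon g (cons_pair (x0, x')) t = RF x0 x' t.
  rewrite /RF /radon int_tupleS; last by solve_mnn.
  rewrite tonelli; last by solve_mnn.
  apply: eq_integral => v' _; rewrite /F /radon1; apply: eq_integral => v0 _.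
  by rewrite dot_cons; congr (g _ _); ring.
rewrite int_tupleS; last by solve_mnn.
under eq_integral do under eq_integral do under eq_integral do rewrite E.
pose e := (m.+1%:R / (q - 1))%R.
pose H x0 v' := (\int[leb]_t F x0 v' t `^ (q / m.+1%:R)) `^ e.
have mH : mnn (fun p : T * 'euc[R]_m => H p.1 p.2) by rewrite /H; solve_mnn.
apply: (@le_trans _ _ (\int[leb]_x0 (C%:E *
    (\int[ltup m]_v' H x0 v') `^ (q - 1)))).
  apply: le_int; first by solve_mnn.
    by apply: mnnM; [apply: mnn_cst; rewrite lee_fin ltW|solve_mnn].
  by move=> x0; rewrite /RF; apply: CP; solve_mnn.
rewrite intZl ?lee_fin ?(ltW C0)//; last by solve_mnn.
rewrite EFinM -muleA; apply: lee_wpmul2l; first by rewrite lee_fin ltW.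
apply: (le_trans (minkowski_integral leb (ltup m) mH q11)).
pose Phi (v : 'euc[R]_m.+1) :=
  (\int[leb]_t g v t `^ (q / m.+2%:R)) `^ (m.+2%:R / (q - 1)).
have mPhi : mnn Phi by rewrite /Phi; solve_mnn.
have Phi0 v : 0 <= Phi v by exact: mnn_ge0 mPhi.
have -> : C1%:E = (C1 `^ (q - 1)^-1)%:E `^ (q - 1).
  by rewrite -poweR_EFin poweRVK ?gt_eqF// lee_fin ltW.
rewrite -[X in _ <= _ * X `^ _]/(\int[ltup m.+1]_v Phi v).
rewrite -poweRM ?lee_fin ?powR_ge0//; last by apply: integral_ge0 => v _.
apply: le_poweR; first exact: ltW.
  by apply: integral_ge0 => v _; exact: poweR_ge0.
rewrite (int_tupleS mPhi) (tonelli leb (ltup m)); last by solve_mnn.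
rewrite -intZl ?lee_fin ?powR_ge0//; last by solve_mnn.
apply: le_int; [by solve_mnn| |move=> v'].
  by apply: mnnM; [apply: mnn_cst; rewrite lee_fin powR_ge0|solve_mnn].
have I0 : 0 <= \int[leb]_y Phi (cons_pair (y, v')).
  by apply: integral_ge0 => y _.
rewrite -[leRHS](poweRK (lt0r_neq0 q1)); last first.
  by rewrite mule_ge0// lee_fin powR_ge0.
apply: le_poweR; first by rewrite invr_ge0 ltW.
  by apply: integral_ge0 => y _; exact: poweR_ge0.
rewrite poweRM ?lee_fin ?powR_ge0// poweR_EFin -powRrM mulVf ?gt_eqF//.
rewrite powRr1 ?(ltW C10)//.
have mgv : mnn (fun p : T * T => g (cons_pair (p.1, v')) p.2) by solve_mnn.
have := C1P (fun v0 => g (cons_pair (v0, v'))) mgv.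
rewrite /H /F /Phi /e.
under eq_integral do rewrite -[X in _ `^ X](divfK (lt0r_neq0 q1)) poweRrM.
by rewrite natr1.
Qed.

End tuple_integral.

(** * Linear changes of variable *)

Section linear_change.
Context {R : realType}.
Notation T := (measurableTypeR R).
Notation leb := (@lebesgue_measure R).
Notation ltup m := (@lebesgue_tuple R m).

Lemma colvK m : cancel (@colv R m) (@tupv R m).
Proof. by move=> x; apply: eq_from_tnth => i; rewrite tnth_mktuple mxE. Qed.

Lemma tupvK m : cancel (@tupv R m) (@colv R m).
Proof. by move=> u; apply/colP => i; rewrite mxE tnth_mktuple. Qed.

Lemma mulvM m (M N : 'M[R]_m) x : mulv (M *m N) x = mulv M (mulv N x).
Proof. by rewrite /mulv tupvK mulmxA. Qed.

Lemma measurable_mulv m (M : 'M[R]_m) : measurable_fun setT (mulv M).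
Proof. by solve_meas. Qed.

Lemma colv_cons m (a : R) (v : 'euc[R]_m) :
  colv (cons_pair (a, v)) = col_mx (a%:M : 'M[R]_1) (colv v) :> 'cV[R]_(1 + m).
Proof.
rewrite -[LHS](@vsubmxK _ 1 m 1); congr col_mx; apply/matrixP => i j.
  by rewrite !mxE (ord1 i) (ord1 j) eqxx mulr1n lshift0 tnth_cons_pair0.
by rewrite !mxE rshift1 tnth_cons_pairS.
Qed.

Lemma tupv_col m (a : 'M[R]_1) (w : 'cV[R]_m) :
  tupv (col_mx a w : 'cV[R]_(1 + m)) = cons_pair (a ord0 ord0, tupv w).
Proof.
apply: (can_inj (@colvK m.+1)); rewrite tupvK colv_cons tupvK.
by rewrite -mx11_scalar.
Qed.

Lemma tadd_cons m (a b : R) (v w : 'euc[R]_m) :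
  tadd (cons_pair (a, v)) (cons_pair (b, w)) = cons_pair ((a + b)%R, tadd v w).
Proof.
apply: eq_from_tnth => i; have [->|i0] := eqVneq i ord0.
  by rewrite tnth_mktuple !tnth_cons_pair0.
have i1m : (i.-1 < m)%N by rewrite prednK ?lt0n// -ltnS.
have -> : i = lift ord0 (Ordinal i1m).
  by apply/val_inj => /=; rewrite /bump/= add1n prednK// lt0n.
by rewrite tnth_mktuple !tnth_cons_pairS tnth_mktuple.
Qed.

Lemma mnn_tadd m (b : 'euc[R]_m) (f : 'euc[R]_m -> \bar R) :
  mnn f -> mnn (fun x => f (tadd x b)).
Proof. by move=> mf; apply: (mnn_comp1 mf); solve_meas. Qed.

Lemma int_tadd m (b : 'euc[R]_m) (f : 'euc[R]_m -> \bar R) : mnn f ->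
  \int[ltup m]_x f (tadd x b) = \int[ltup m]_x f x.
Proof.
elim: m b f => [|m IH] b f mf.
  rewrite !int_tuple0//; last exact: mnn_tadd.
  by congr f; apply: eq_from_tnth => -[].
rewrite -(uncons_pairK b); case: (uncons_pair b) => b0 b'.
rewrite (int_tupleS mf) (int_tupleS (mnn_tadd _ mf)).
have mc (a : R) : mnn (fun x => f (cons_pair (a, x))).
  by apply: (mnn_comp1 mf); solve_meas.
have mI : mnn (fun a : T => \int[ltup m]_x f (cons_pair (a, x))).
  by apply: mnn_int; apply: (mnn_comp1 mf); solve_meas.
rewrite -(int_shift b0 mI); apply: eq_integral => a _.
rewrite -(IH b' _ (mc (a + b0)%R)).
by apply: eq_integral => x _; rewrite tadd_cons.
Qed.

(** The change of variables formula as an inequality with an unspecified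
    constant. In this form it passes to products at once, so that it can be
    checked on elementary block matrices. *)
Definition bounded_jac m (M : 'M[R]_m) := exists2 c : R, (0 <= c)%R &
  forall f : 'euc[R]_m -> \bar R, mnn f ->
    \int[ltup m]_x f (mulv M x) <= c%:E * \int[ltup m]_x f x.

Lemma bounded_jac_mul m (M N : 'M[R]_m) :
  bounded_jac M -> bounded_jac N -> bounded_jac (M *m N).
Proof.
move=> [c c0 cP] [d d0 dP]; exists (d * c)%R; first exact: mulr_ge0.
move=> f mf; under eq_integral do rewrite mulvM.
have mM : mnn (fun x => f (mulv M x)).
  by apply: (mnn_comp1 mf); exact: measurable_mulv.
apply: (le_trans (dP _ mM)); rewrite EFinM -muleA.
by apply: lee_wpmul2l; [rewrite lee_fin|exact: cP].
Qed.

Lemma mulv_block m (a : R) (r : 'rV[R]_m) (c : 'cV[R]_m) (N : 'M[R]_m) x0 x :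
  mulv (block_mx (a%:M : 'M[R]_1) r c N : 'M[R]_(1 + m)) (cons_pair (x0, x)) =
  cons_pair ((a * x0 + (r *m colv x) ord0 ord0)%R,
    tupv (x0 *: c + N *m colv x)).
Proof.
rewrite /mulv colv_cons mul_block_col tupv_col; congr (cons_pair (_, tupv _)).
  by rewrite mxE -scalar_mxM mxE eqxx mulr1n.
by rewrite mul_mx_scalar.
Qed.

Lemma bounded_jac_ushear m (r : 'rV[R]_m) :
  bounded_jac (block_mx 1%:M r 0 1%:M : 'M[R]_(1 + m)).
Proof.
exists 1%R => // f mf; rewrite mul1e.
have mfM : mnn (fun x => f (mulv (block_mx 1%:M r 0 1%:M : 'M[R]_(1 + m)) x)).
  by apply: (mnn_comp1 mf); exact: measurable_mulv.
have mc : mnn (fun z : T * 'euc[R]_m => f (cons_pair (z.1, z.2))).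
  by apply: (mnn_comp1 mf); solve_meas.
rewrite (int_tupleS mfM) (int_tupleS mf) (tonelli leb (ltup m)); last first.
  by apply: (mnn_comp1 mfM); solve_meas.
rewrite [leRHS](tonelli _ _ mc) le_eqVlt; apply/orP; left; apply/eqP.
apply: eq_integral => x _.
have mx : mnn (fun a : T => f (cons_pair (a, x))) by apply: (mnn_comp1 mf);
  solve_meas.
rewrite -(int_shift ((r *m colv x) ord0 ord0) mx).
apply: eq_integral => a _; rewrite mulv_block mul1r;
  congr (f (cons_pair (_, _))).
by rewrite scaler0 add0r mul1mx colvK.
Qed.

Lemma bounded_jac_lshear m (c : 'cV[R]_m) :
  bounded_jac (block_mx 1%:M 0 c 1%:M : 'M[R]_(1 + m)).
Proof.
exists 1%R => // f mf; rewrite mul1e.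
have mfM : mnn (fun x => f (mulv (block_mx 1%:M 0 c 1%:M : 'M[R]_(1 + m)) x)).
  by apply: (mnn_comp1 mf); exact: measurable_mulv.
rewrite (int_tupleS mfM) (int_tupleS mf) le_eqVlt; apply/orP; left; apply/eqP.
apply: eq_integral => a _.
have ma : mnn (fun x => f (cons_pair (a, x))) by apply: (mnn_comp1 mf);
  solve_meas.
rewrite -(int_tadd (tupv (a *: c)) ma); apply: eq_integral => x _.
rewrite mulv_block mul1r mul0mx [X in (_ + X)%R]mxE addr0 mul1mx.
congr (f (cons_pair (_, _))); apply: eq_from_tnth => i.
by rewrite !tnth_mktuple !mxE addrC.
Qed.

Lemma bounded_jac_diag m (a : R) (N : 'M[R]_m) : a != 0%R -> bounded_jac N ->
  bounded_jac (block_mx a%:M 0 0 N : 'M[R]_(1 + m)).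
Proof.
move=> a0 [c c0 cP]; exists (c * `|a|^-1)%R;
  first by rewrite mulr_ge0 ?invr_ge0.
move=> f mf.
have mfM : mnn (fun x => f (mulv (block_mx a%:M 0 0 N : 'M[R]_(1 + m)) x)).
  by apply: (mnn_comp1 mf); exact: measurable_mulv.
have mI : mnn (fun x0 : T => \int[ltup m]_x f (cons_pair (x0, x))).
  by apply: mnn_int; apply: (mnn_comp1 mf); solve_meas.
have mIa : mnn (fun x0 : T => \int[ltup m]_x f (cons_pair ((a * x0)%R, x))).
  by apply: mnn_int; apply: (mnn_comp1 mf); solve_meas.
rewrite (int_tupleS mfM) (int_tupleS mf) EFinM -muleA -(int_scale a0 mI) -intZl
  ?lee_fin//.
apply: le_int.
- by apply: mnn_int; apply: (mnn_comp1 mfM); solve_meas.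
- by apply: mnnM => //; apply: mnn_cst; rewrite lee_fin.
move=> x0.
have mx0 : mnn (fun x => f (cons_pair ((a * x0)%R, x))).
  by apply: (mnn_comp1 mf); solve_meas.
apply: le_trans (cP _ mx0).
rewrite le_eqVlt; apply/orP; left; apply/eqP; apply: eq_integral => x _.
rewrite mulv_block mul0mx [X in (_ + X)%R]mxE addr0;
  congr (f (cons_pair (_, _))).
by rewrite scaler0 add0r.
Qed.

(** With an invertible corner a, the matrix is the product of a lower shear, of
    the block diagonal matrix of a and its Schur complement, and of an upper
    shear. *)
Lemma bounded_jac_pivot m (a : R) (r : 'rV[R]_m) (c : 'cV[R]_m) (N : 'M[R]_m) :
  a != 0%R ->
  (forall N : 'M[R]_m, N \in unitmx -> bounded_jac N) ->
  (block_mx a%:M r c N : 'M[R]_(1 + m)) \in unitmx ->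
  bounded_jac (block_mx a%:M r c N : 'M[R]_(1 + m)).
Proof.
move=> a0 IH.
have -> : (block_mx a%:M r c N : 'M[R]_(1 + m)) =
   (block_mx 1%:M 0 (a^-1 *: c) 1%:M) *m
   ((block_mx a%:M 0 0 (N - a^-1 *: (c *m r))) *m (block_mx 1%:M (a^-1 *: r) 0
     1%:M)).
  rewrite !mulmx_block !mul1mx !mul0mx !mulmx0 !mulmx1 !addr0 !add0r.
  rewrite !mul_scalar_mx !mul_mx_scalar.
  congr block_mx.
  - by rewrite scalerA divff// scale1r.
  - by rewrite scalerA divff// scale1r.
  - by rewrite -!scalemxAr -scalemxAl scalerA mulfV// scale1r addrC subrK.
rewrite !unitmx_mul => /andP[_ /andP[hD _]].
apply: bounded_jac_mul; first exact: bounded_jac_lshear.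
apply: bounded_jac_mul; last exact: bounded_jac_ushear.
apply: bounded_jac_diag => //; apply: IH.
by move: hD; rewrite !unitmxE det_ublock unitrM => /andP[].
Qed.

(** Gaussian elimination on the first column. If the corner vanishes, some
    other entry of this column does not, and adding its row to the first one
    moves it into the corner. *)
Lemma bounded_jac_unit m (M : 'M[R]_m) : M \in unitmx -> bounded_jac M.
Proof.
elim: m M => [|m IH] M uM.
  exists 1%R => // f mf; rewrite mul1e le_eqVlt; apply/orP; left; apply/eqP.
  by apply: eq_integral => x _; congr f; apply: eq_from_tnth => -[].
rewrite -(submxK (M : 'M[R]_(1 + m))) in uM *.
set a := ulsubmx _ in uM *; set r := ursubmx _ in uM *.
set c := dlsubmx _ in uM *; set N := drsubmx _ in uM *.
rewrite (mx11_scalar a) in uM *; move: (a ord0 ord0) uM => {a} a uM.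
have [a0|a0] := eqVneq a 0%R; last exact: bounded_jac_pivot.
have [i ci0] : exists i, c i ord0 != 0%R.
  apply/existsP; apply: contraLR uM; rewrite negb_exists => /forallP c0.
  have -> : c = 0%R.
    by apply/colP => i; rewrite [RHS]mxE; apply/eqP; rewrite -[_ == _]negbK;
      exact: c0.
  by rewrite unitmxE (@det_ublock _ 1 m) a0 det_scalar1 mul0r unitr0.
pose E (s : R) := block_mx 1%:M (s *: delta_mx ord0 i) 0 1%:M : 'M[R]_(1 + m).
have EE : E (-1)%R *m E 1%R = 1%:M.
  rewrite /E mulmx_block !mul1mx !mul0mx !mulmx0 !mulmx1 !addr0 !add0r.
  by rewrite scaleN1r scale1r subrr -scalar_mx_block.
have uE : E 1%R \in unitmx.
  by have := mulmx1_unit EE => -[].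
rewrite -[X in bounded_jac X]mul1mx -EE -mulmxA.
apply: bounded_jac_mul; first exact: bounded_jac_ushear.
have : E 1%R *m block_mx a%:M r c N \in unitmx by rewrite unitmx_mul uE.
rewrite /E mulmx_block !mul1mx !mul0mx !add0r.
rewrite (mx11_scalar (a%:M + _)).
apply: bounded_jac_pivot => //.
rewrite a0 scale1r !mxE eqxx mul0rn add0r (bigD1 i)//= big1 => [|j ji].
  by rewrite mxE !eqxx mul1r addr0.
by rewrite mxE (negbTE ji) andbF mul0r.
Qed.

End linear_change.

(** * Convolution with the measure on the graph *)

Section assembly.
Context {R : realType}.
Notation T := (measurableTypeR R).
Notation leb := (@lebesgue_measure R).
Notation ltup m := (@lebesgue_tuple R m).

(** [radon_mixed] for m = q - 2, where both mixed norms are Lebesgue norms. *)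
Lemma radon_bound (q : R) m : (2 < q)%R -> (m%:R = q - 2)%R ->
  exists2 C : R, (0 < C)%R &
  forall g : 'euc[R]_m -> T ->
    \bar R, mnn (fun p : 'euc[R]_m * T => g p.1 p.2) ->
  \int[ltup m]_x \int[leb]_t radon g x t `^ q <=
  C%:E * (\int[ltup m]_v \int[leb]_t g v t `^ (q / (q - 1))) `^ (q - 1).
Proof.
move=> q2 mq; have [|C C0 CP] := @radon_mixed R q m q2; first by rewrite mq.
exists C => // g mg; apply: (le_trans (CP g mg)).
have q1 : (0 < q - 1)%R by rewrite subr_gt0 (lt_trans _ q2)// ltr1n.
have -> : (m.+1%:R = q - 1)%R by rewrite -natr1 mq; ring.
rewrite divff ?gt_eqF// le_eqVlt; apply/orP; left; apply/eqP.
congr (_ * _ `^ _); apply: eq_integral => v _.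
by rewrite poweRe1// integral_ge0// => t _; exact: poweR_ge0.
Qed.

Section forms.
Variable m : nat.
Implicit Types (M : 'M[R]_m) (X Y : 'cV[R]_m).

Definition blin M X Y : R := (X^T *m M *m Y) ord0 ord0.

Lemma blDr M X Y Z : (blin M X (Y + Z) = blin M X Y + blin M X Z)%R.
Proof. by rewrite /blin mulmxDr mxE. Qed.
Lemma blNr M X Y : (blin M X (- Y) = - blin M X Y)%R.
Proof. by rewrite /blin mulmxN mxE. Qed.
Lemma blDl M X Y Z : (blin M (X + Y) Z = blin M X Z + blin M Y Z)%R.
Proof. by rewrite /blin linearD /= !mulmxDl mxE. Qed.
Lemma blNl M X Y : (blin M (- X) Y = - blin M X Y)%R.
Proof. by rewrite /blin linearN /= !mulNmx mxE. Qed.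
Lemma bl_tr M X Y : blin M^T X Y = blin M Y X.
Proof.
rewrite /blin (_ : X^T *m M^T *m Y = (Y^T *m M *m X)^T)%R ?mxE//.
by rewrite !trmx_mul trmxK mulmxA.
Qed.

Lemma bl_addM M N X Y : (blin (M + N) X Y = blin M X Y + blin N X Y)%R.
Proof. by rewrite /blin mulmxDr mulmxDl mxE. Qed.
Lemma bl_scaleM a M X Y : (blin (a *: M) X Y = a * blin M X Y)%R.
Proof. by rewrite /blin -scalemxAr -scalemxAl mxE. Qed.
Lemma bl_oppM M X Y : (blin (- M) X Y = - blin M X Y)%R.
Proof. by rewrite /blin mulmxN mulNmx mxE. Qed.
Lemma bilin_bl M (x y : 'euc[R]_m) : bilin M x y = blin M (colv x) (colv y).
Proof. by []. Qed.
Lemma dot_bl M (x y : 'euc[R]_m) : dot x (mulv M y) = blin M (colv x) (colv y).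
Proof. by rewrite -bilinE. Qed.
Lemma colv_tadd (x y : 'euc[R]_m) : colv (tadd x y) = (colv x + colv y)%R.
Proof. by apply/colP => i; rewrite !mxE tnth_mktuple. Qed.
Lemma colv_topp (x : 'euc[R]_m) : colv (topp x) = (- colv x)%R.
Proof. by apply/colP => i; rewrite !mxE tnth_mktuple. Qed.
Lemma colv_mulv M (x : 'euc[R]_m) : colv (mulv M x) = (M *m colv x)%R.
Proof. by rewrite tupvK. Qed.

End forms.


Section heis.
Variables (n : nat) (A : 'M[R]_(n + n)).
Hypothesis hA : (A^T = A)%R.
Local Notation J := (sympl_mx R n).
Local Notation E := 'euc[R]_(n + n).
Hypothesis hdet : (\det (2%:R *: A + J) != 0)%R.
Let M := (2%:R *: A + J)%R.
Let phi (y : E) : R := bilin A y y.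

Lemma sympl_tr : (J^T = - J)%R.
Proof.
by rewrite /sympl_mx tr_block_mx opp_block_mx linearN /= !trmx0 trmx1 oppr0
  opprK.
Qed.

Lemma bl_sympl X : blin J X X = 0%R.
Proof.
have := bl_tr J X X; rewrite sympl_tr bl_oppM => h.
by lra.
Qed.

Lemma M_unit : M \in unitmx.
Proof. by rewrite unitmxE unitfE. Qed.

(** The point u = (2A + J) (x - y) is the new variable of integration, in which
    the phase is the inner product with x, after the shears by phi at x and at
    x - y. The quadratic terms in x cancel because J is antisymmetric, and the
    mixed terms combine because A is symmetric. *)
Lemma phase_identity (x y : E) (t : R) : let u :=
  tadd (mulv (- M) y) (mulv M x) in
  mulv (invmx M) u = tadd x (topp y) /\
  (t - phi x + dot x u - phi (tadd x (topp y)) =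
   t + - phi y + bilin J x (topp y))%R.
Proof.
move=> u; have uE : u = mulv M (tadd x (topp y)).
  apply: (can_inj (@colvK R _));
    rewrite colv_tadd !colv_mulv colv_tadd colv_topp.
  by rewrite mulmxBr mulNmx addrC.
split.
  rewrite uE -mulvM mulVmx ?M_unit//.
  by apply: (can_inj (@colvK R _)); rewrite colv_mulv mul1mx.
rewrite uE dot_bl /phi !bilin_bl colv_tadd colv_topp.
set X := colv x; set Y := colv y.
rewrite /M !(bl_addM, bl_scaleM, blDr, blNr, blDl, blNl) bl_sympl.
have -> : blin A Y X = blin A X Y by rewrite -{1}hA bl_tr.
by ring.
Qed.

Definition conv_abs (F : 'heis[R]_n -> \bar R) (z : 'heis[R]_n) : \bar R :=
  \int[ltup (n + n)]_y F (hmul z (hinv (graph_pt A y))).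

Definition sheared (F : 'heis[R]_n -> \bar R) (u : E) (s : T) : \bar R :=
  F (mulv (invmx M) u, (s : R) - phi (mulv (invmx M) u))%R.

Lemma mnn_sheared F : mnn F -> mnn (fun p : E * T => sheared F p.1 p.2).
Proof. by move=> mF; apply: (mnn_comp1 mF); rewrite /phi; solve_meas. Qed.

Lemma measurable_hmul_hinv d (X : measurableType d) (a b : X -> 'heis[R]_n) :
  measurable_fun setT a -> measurable_fun setT b ->
  measurable_fun setT (fun x => hmul (a x) (hinv (b x))).
Proof. by move=> ma mb; rewrite /hmul /hinv /=; solve_meas. Qed.

Lemma mnn_conv_abs F : mnn F -> mnn (conv_abs F).
Proof.
move=> mF; apply: mnn_int; apply: (mnn_comp1 mF).
by apply: measurable_hmul_hinv; rewrite /graph_pt; solve_meas.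
Qed.

(** The substitution y -> (2A + J) (x - y). The constant c, from [bounded_jac],
    does not depend on (x, t). *)
Lemma conv_abs_le : exists2 c : R, (0 <= c)%R & forall F, mnn F ->
  forall x t, conv_abs F (x, t) <= c%:E * radon (sheared F) x (t - phi x)%R.
Proof.
have [|c c0 cP] := @bounded_jac_unit R _ (- M)%R.
  by rewrite -scaleN1r unitmxZ ?M_unit// unitrN1.
exists c => // F mF x t.
pose Psi u := sheared F u (t - phi x + dot x u)%R.
have mPsi : mnn Psi.
  by have := mnn_sheared mF => H; rewrite /Psi; solve_mnn.
rewrite /radon -/(Psi _) -(int_tadd (mulv M x) mPsi).
apply: le_trans (cP _ (mnn_tadd (mulv M x) mPsi)).
rewrite /conv_abs le_eqVlt; apply/orP; left; apply/eqP.
apply: eq_integral => y _; rewrite /Psi /sheared.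
have [-> E2] := phase_identity x y t.
by rewrite E2.
Qed.

Lemma haarE (h : 'heis[R]_n -> \bar R) : mnn h ->
  \int[@haar R n]_z h z = \int[ltup (n + n)]_x \int[leb]_t h (x, t).
Proof. by move=> [mh h0]; rewrite /haar fubini_tonelli1. Qed.

(** The shear of t by - phi(x) disappears by translation invariance in t for
    each x, and so does the one that is hidden in [sheared]. *)
Lemma conv_abs_bound (q : R) : (2 < q)%R -> ((n + n)%:R = q - 2)%R ->
  exists2 K : R, (0 <= K)%R & forall F, mnn F ->
  \int[@haar R n]_z conv_abs F z `^ q <=
  K%:E * (\int[@haar R n]_z F z `^ (q / (q - 1))) `^ (q - 1).
Proof.
move=> q2 nq; have [c1 c10 c1P] := conv_abs_le.
have [C C0 CP] := radon_bound q2 nq.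
have q0 : (0 < q)%R by exact: lt_trans q2.
have q1 : (0 < q - 1)%R by rewrite subr_gt0 (lt_trans _ q2)// ltr1n.
have [|c2 c20 c2P] := @bounded_jac_unit R _ (invmx M).
  by rewrite unitmx_inv M_unit.
exists (c1 `^ q * (C * c2 `^ (q - 1)))%R.
  by rewrite !mulr_ge0 ?powR_ge0// ltW.
move=> F mF; have mC := mnn_conv_abs mF.
have mG := mnn_sheared mF; have mR := mnn_radon mG.
pose p := (q / (q - 1))%R.
have mFp : mnn (fun z => F z `^ p) by solve_mnn.
have mFpc : mnn (fun z : E * T => F (z.1, z.2) `^ p).
  by apply: mnnX; apply: (mnn_comp1 mF); solve_meas.
have mCc : mnn (fun z : E * T => conv_abs F (z.1, z.2) `^ q).
  by apply: mnnX; apply: (mnn_comp1 mC); solve_meas.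
have mCq : mnn (fun z => conv_abs F z `^ q) by exact: mnnX.
rewrite !haarE//.
have mRp (x : E) : mnn (fun t : T => radon (sheared F) x t `^ q) by solve_mnn.
apply: (@le_trans _ _ (\int[ltup (n + n)]_x ((c1 `^ q)%:E *
    \int[leb]_t radon (sheared F) x t `^ q))).
  apply: le_int; first by apply: mnn_int.
    by apply: mnnM; [apply: mnn_cst; rewrite lee_fin powR_ge0|solve_mnn].
  move=> x; rewrite -(int_shift (- phi x)%R (mRp x)) -intZl ?lee_fin
    ?powR_ge0//.
    apply: le_int.
    - by apply: (mnn_comp2 (g := fun x t => conv_abs F (x, t) `^ q) mCc);
      solve_meas.
    - by apply: mnnM; [apply: mnn_cst; rewrite lee_fin powR_ge0|solve_mnn].
    move=> t; rewrite -poweR_EFin -poweRM ?lee_fin//.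
      apply: le_poweR; [exact: ltW|exact: mnn_ge0|exact: c1P].
    exact: (mnn_ge0 (x, (t - phi x)%R) mR).
  by solve_mnn.
rewrite intZl ?lee_fin ?powR_ge0//; last by solve_mnn.
rewrite EFinM -muleA; apply: lee_wpmul2l; first by rewrite lee_fin powR_ge0.
apply: (le_trans (CP _ mG)).
rewrite EFinM -muleA; apply: lee_wpmul2l; first by rewrite lee_fin ltW.
have I0 : 0 <= \int[ltup (n + n)]_x \int[leb]_t F (x, t) `^ p.
  by apply: integral_ge0 => x _; apply: integral_ge0 => t _; exact: poweR_ge0.
rewrite -poweR_EFin -poweRM ?lee_fin//.
apply: le_poweR; first exact: ltW.
  by apply: integral_ge0 => x _; apply: integral_ge0 => t _; exact: poweR_ge0.
have mI : mnn (fun x : E => \int[leb]_t F (x, t) `^ p).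
  by apply: mnn_int.
apply: le_trans (c2P _ mI).
rewrite le_eqVlt; apply/orP; left; apply/eqP; apply: eq_integral => u _.
have mu : mnn (fun t : T => F (mulv (invmx M) u, t) `^ p).
  by apply: (mnn_comp2 (g := fun x t => F (x, t) `^ p) mFpc); solve_meas.
by rewrite -(int_shift (- phi (mulv (invmx M) u))%R mu).
Qed.

End heis.
End assembly.

(** * Complex-valued functions and norms *)

Section complex_parts.
Context {R : realType}.

Local Notation normc := ComplexField.Normc.normc.

Lemma normc_sqrt (x : R[i]) : normc x = Num.sqrt (complex.Re x ^+ 2 +
  complex.Im x ^+ 2)%R.
Proof. by case: x. Qed.

Lemma Re_le_normc (x : R[i]) : (`|complex.Re x| <= normc x)%R.
Proof.
by rewrite normc_sqrt -sqrtr_sqr ler_wsqrtr// lerDl sqr_ge0.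
Qed.

Lemma Im_le_normc (x : R[i]) : (`|complex.Im x| <= normc x)%R.
Proof.
by rewrite normc_sqrt -sqrtr_sqr ler_wsqrtr// lerDr sqr_ge0.
Qed.

Lemma normc_le_ReIm (x : R[i]) : (normc x <= `|complex.Re x| + `|complex.Im
  x|)%R.
Proof.
rewrite normc_sqrt -[leRHS]ger0_norm ?addr_ge0// -sqrtr_sqr ler_wsqrtr//.
rewrite sqrrD !real_normK ?num_real// lerD2r lerDl.
by rewrite mulrn_wge0// mulr_ge0.
Qed.

Lemma normc_ge0 (x : R[i]) : (0 <= normc x)%R.
Proof. by rewrite normc_sqrt sqrtr_ge0. Qed.

Lemma mnn_normc d (T : measurableType d) (f : T -> R[i]) : cmeasurable f ->
  mnn (fun x => (normc (f x))%:E).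
Proof.
move=> [mRe mIm]; apply: mnn_EFin => [|x]; last exact: normc_ge0.
under eq_fun do rewrite normc_sqrt.
apply: (measurableT_comp (continuous_measurable_fun (@sqrt_continuous R))).
by apply: measurable_funD; apply: measurable_funX.
Qed.

(** The positive and negative parts have measurable integrals, whether or not
    their difference makes sense: this is what measurability of a convolution
    means at the points where it diverges. *)
Lemma measurable_Rint d1 d2 (X : measurableType d1) (Y : measurableType d2)
    (m : {sigma_finite_measure set Y -> \bar R}) (h : X -> Y -> R) :
  measurable_fun setT (fun p : X * Y => h p.1 p.2) ->
  measurable_fun setT (fun x => (\int[m]_y h x y)%R).
Proof.
move=> mh; rewrite /Rintegral.
have mE : measurable_fun setT (fun p : X * Y => (h p.1 p.2)%:E).
  exact/measurable_EFinP.
have mp : mnn (fun x => \int[m]_y (EFin \o h x)^\+ y).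
  apply: (@mnn_int _ _ _ _ _ m (fun x y => (EFin \o h x)^\+ y)); split.
    rewrite (_ : (fun _ => _) = (fun p : X * Y => (h p.1 p.2)%:E)^\+).
      exact: measurable_funepos.
    by apply/funext => p; rewrite !funeposE.
  by move=> z; exact: funepos_ge0.
have mn : mnn (fun x => \int[m]_y (EFin \o h x)^\- y).
  apply: (@mnn_int _ _ _ _ _ m (fun x y => (EFin \o h x)^\- y)); split.
    rewrite (_ : (fun _ => _) = (fun p : X * Y => (h p.1 p.2)%:E)^\-).
      exact: measurable_funeneg.
    by apply/funext => p; rewrite !funenegE.
  by move=> z; exact: funeneg_ge0.
apply: measurableT_comp; first exact: fine_measurable.
under eq_fun do rewrite integralE.
by apply: emeasurable_funB; [have [] := mp|have [] := mn].
Qed.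

Lemma Rint_le d (X : measurableType d) (m : {measure set X -> \bar R})
    (h : X -> R) (H : X -> \bar R) : measurable_fun setT h -> mnn H ->
  (forall x, (`|h x|)%:E <= H x) ->
  (`|(\int[m]_x h x)%R|)%:E <= \int[m]_x H x.
Proof.
move=> mh mH hH; rewrite /Rintegral.
apply: (@le_trans _ _ `|\int[m]_x (h x)%:E|).
  by case: (\int[m]_x (h x)%:E) => [r| |] //=; rewrite normr0 leey.
have mhE : measurable_fun setT (fun x => (h x)%:E) by exact/measurable_EFinP.
apply: (le_trans (le_abse_integral m measurableT mhE)).
apply: le_int => //; split=> //.
exact: measurableT_comp.
Qed.

End complex_parts.

Section final.
Context {R : realType}.
Variables (n : nat) (A : 'M[R]_(n + n)).
Local Notation normc := ComplexField.Normc.normc.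
Local Notation T := (measurableTypeR R).

Lemma int_mu_quad (h : 'heis[R]_n -> \bar R) : mnn h ->
  \int[mu_quad A]_w h w = \int[@lebesgue_tuple R (n + n)]_y h (graph_pt A y).
Proof.
move=> [mh h0]; have mg := measurable_graph_pt A.
pose m : {measure set 'heis[R]_n -> \bar R} :=
  pushforward (@lebesgue_tuple R (n + n)) (graph_pt A).
transitivity (\int[m mg]_w h w).
  by apply: eq_measure_integral => B mB _; exact: mu_quadE.
by rewrite ge0_integral_pushforward.
Qed.

Section function.
Variable f : 'heis[R]_n -> R[i].
Hypothesis mf : cmeasurable f.
Let F z := (normc (f z))%:E.
Let mF : mnn F. Proof. exact: mnn_normc. Qed.

Lemma mnn_translate z : mnn (fun w => F (hmul z (hinv w))).
Proof. by apply: (mnn_comp1 mF); apply: measurable_hmul_hinv; solve_meas. Qed.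

Lemma conv_absE z :
  \int[mu_quad A]_w F (hmul z (hinv w)) = conv_abs A F z.
Proof. by rewrite int_mu_quad//; exact: mnn_translate. Qed.

Lemma measurable_Re_translate d (X : measurableType d) (a b : X -> 'heis[R]_n) :
  measurable_fun setT a -> measurable_fun setT b ->
  measurable_fun setT (fun x => complex.Re (f (hmul (a x) (hinv (b x))))).
Proof.
move=> ma mb; have [mRe _] := mf.
by apply: (measurableT_comp mRe); exact: measurable_hmul_hinv.
Qed.

Lemma measurable_Im_translate d (X : measurableType d) (a b : X -> 'heis[R]_n) :
  measurable_fun setT a -> measurable_fun setT b ->
  measurable_fun setT (fun x => complex.Im (f (hmul (a x) (hinv (b x))))).
Proof.
move=> ma mb; have [_ mIm] := mf.
by apply: (measurableT_comp mIm); exact: measurable_hmul_hinv.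
Qed.

Lemma hconv_integrable_fin z : conv_abs A F z < +oo ->
  hconv_integrable (mu_quad A) f z.
Proof.
rewrite -conv_absE => fin.
have mR := measurable_Re_translate (measurable_cst z) (@measurable_id _
  'heis[R]_n setT).
have mI := measurable_Im_translate (measurable_cst z) (@measurable_id _
  'heis[R]_n setT).
split; apply/integrableP; split; try exact/measurable_EFinP.
  apply: le_lt_trans fin; apply: le_int.
  - by split=> //; apply: measurableT_comp => //; exact/measurable_EFinP.
  - exact: mnn_translate.
  - by move=> w; rewrite /F /= lee_fin Re_le_normc.
apply: le_lt_trans fin; apply: le_int.
- by split=> //; apply: measurableT_comp => //; exact/measurable_EFinP.
- exact: mnn_translate.
- by move=> w; rewrite /F /= lee_fin Im_le_normc.
Qed.

Lemma cmeasurable_hconv : cmeasurable (hconv (mu_quad A) f).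
Proof.
split; rewrite /hconv /cintegral /=.
- apply: (@measurable_Rint _ _ _ _ _ (mu_quad A)
    (fun z w => complex.Re (f (hmul z (hinv w))))).
  by apply: measurable_Re_translate; solve_meas.
- apply: (@measurable_Rint _ _ _ _ _ (mu_quad A)
    (fun z w => complex.Im (f (hmul z (hinv w))))).
  by apply: measurable_Im_translate; solve_meas.
Qed.

(** The factor 2 comes from bounding the real and imaginary parts separately. *)
Lemma normc_hconv_le z :
  (normc (hconv (mu_quad A) f z))%:E <= 2%:E * conv_abs A F z.
Proof.
rewrite -conv_absE.
apply: (@le_trans _ _ (`|complex.Re (hconv (mu_quad A) f z)|%:E +
  `|complex.Im (hconv (mu_quad A) f z)|%:E)).
  by rewrite -EFinD lee_fin normc_le_ReIm.
have -> : 2%:E * \int[mu_quad A]_w F (hmul z (hinv w)) =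
   \int[mu_quad A]_w F (hmul z (hinv w)) + \int[mu_quad A]_w F (hmul z (hinv
     w)).
  by rewrite -mule2n mule_natl.
have mt := mnn_translate z.
rewrite /hconv /cintegral /=; apply: leeD; apply: Rint_le => //.
- by apply: measurable_Re_translate; solve_meas.
- by move=> w; rewrite lee_fin Re_le_normc.
- by apply: measurable_Im_translate; solve_meas.
- by move=> w; rewrite lee_fin Im_le_normc.
Qed.

End function.
End final.

Lemma cLnormE (R : realType) d (X : measurableType d)
    (mu : {measure set X -> \bar R}) (r : R) (h : X -> R[i]) :
  cLnorm mu r%:E h =
  (\int[mu]_z (ComplexField.Normc.normc (h z))%:E `^ r) `^ r^-1.
Proof.
rewrite /cLnorm unlock; apply: (congr1 (fun I => I `^ r^-1)).
apply: eq_integral => z _.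
by rewrite gee0_abs// lee_fin normc_ge0.
Qed.

(** The integrals that define the convolution converge wherever [conv_abs] is
    finite, that is almost everywhere, its q-th power being integrable. *)
Lemma hconv_bound (R : realType) (n : nat) (A : 'M[R]_(n + n)) (q : R) :
  (A^T = A)%R -> (\det (2%:R *: A + sympl_mx R n) != 0)%R ->
  (2 < q)%R -> ((n + n)%:R = q - 2)%R ->
  exists2 K : R, (0 <= K)%R & forall f : 'heis[R]_n -> R[i], cmeasurable f ->
    let N := \int[@haar R n]_z
      (ComplexField.Normc.normc (f z))%:E `^ (q / (q - 1)) in
    N < +oo ->
    {ae @haar R n, forall z, hconv_integrable (mu_quad A) f z} /\
    \int[@haar R n]_z
      (ComplexField.Normc.normc (hconv (mu_quad A) f z))%:E `^ q <=
    K%:E * N `^ (q - 1).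
Proof.
move=> hA hdet q2 nq; have [K K0 KP] := conv_abs_bound hA hdet q2 nq.
have q0 : (0 < q)%R by exact: lt_trans q2.
exists (2 `^ q * K)%R; first by rewrite mulr_ge0 ?powR_ge0.
move=> f mf; pose F z := (ComplexField.Normc.normc (f z))%:E.
move=> N; rewrite {}/N => fin.
have mF : mnn F by exact: mnn_normc.
have mC : mnn (conv_abs A F) by exact: mnn_conv_abs.
have mCq : mnn (fun z => conv_abs A F z `^ q) by exact: mnnX.
have est := KP F mF.
split.
  have : \int[@haar R n]_z conv_abs A F z `^ q < +oo.
    apply: (le_lt_trans est); rewrite lte_mul_pinfty ?lee_fin//.
    exact: poweR_lty.
  move=> /(int_lty_ae mCq); apply: filterS => z /lty_poweRy zfin.
  by apply: hconv_integrable_fin => //; apply: zfin; rewrite gt_eqF.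
have mH : mnn (fun z => (ComplexField.Normc.normc (hconv (mu_quad A) f z))%:E).
  by apply: mnn_normc; exact: cmeasurable_hconv.
rewrite EFinM -muleA.
apply: le_trans (lee_wpmul2l _ est); last by rewrite lee_fin powR_ge0.
rewrite -intZl ?lee_fin ?powR_ge0//; apply: le_int; [exact: mnnX| |].
  by apply: mnnM => //; apply: mnn_cst; rewrite lee_fin powR_ge0.
move=> z; rewrite -poweR_EFin -poweRM ?lee_fin//; last exact: mnn_ge0.
apply: le_poweR; [exact: ltW|exact: mnn_ge0 mH|exact: normc_hconv_le].
Qed.

Local Close Scope ereal_scope.

Theorem theorem3 (R : realType) (n : nat) (A : 'M[R]_(n + n))
    (hn : (1 <= n)%N) (hA : A^T = A)
    (hdet : \det (2%:R *: A + sympl_mx R n) != 0) :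
  hconv_bounded (mu_quad A)
    (((2 * n + 2)%:R / (2 * n + 1)%:R)%:E) ((2 * n + 2)%:R%:E).
Proof.
pose q : R := (2 * n + 2)%:R.
have qE : q = n%:R * 2 + 2 by rewrite /q natrD natrM mulrC.
have n1 : 1 <= n%:R :> R by rewrite ler1n.
have q2 : 2 < q by rewrite qE; lra.
have q0 : 0 < q by exact: lt_trans q2.
have q1 : 0 < q - 1 by rewrite subr_gt0 (lt_trans _ q2)// ltr1n.
have nq : (n + n)%:R = q - 2 by rewrite qE natrD; ring.
have -> : (2 * n + 1)%:R = q - 1 :> R by rewrite qE natrD natrM; ring.
rewrite -/q; have [K K0 KP] := hconv_bound hA hdet q2 nq.
set p := q / (q - 1) in KP *.
have p0 : 0 < p by rewrite divr_gt0.
exists (K `^ q^-1) => f mf; rewrite !cLnormE => fin.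
have {fin}/(KP f mf)[integrable_ae est] : (\int[@haar R n]_z
    (ComplexField.Normc.normc (f z))%:E `^ p < +oo)%E.
  by apply: lty_poweRy fin; rewrite invr_eq0 gt_eqF.
split; [exact: integrable_ae|exact: cmeasurable_hconv|].
have qV0 : 0 <= q^-1 by rewrite invr_ge0 ltW.
apply: le_trans (le_poweR qV0 _ est) _.
  by apply: integral_ge0 => z _; exact: poweR_ge0.
rewrite poweRM ?lee_fin ?poweR_ge0// -poweRrM poweR_EFin.
by rewrite (_ : (q - 1) / q = p^-1)// /p invf_div.
Qed.
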